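(* Let $(U(n))_{n\ge1}$ be independent random variables with $U(n)$ uniformly distributed on $\{1,\dots,n\}$, and let $(X_n)_{n\ge1}$ be independent and identically distributed real random variables, the sequence $(X_n)$ being independent of the sequence $(U(n))$. Define $R_1=0$ and $R_{n+1}=R_{U(n)}+X_n$ for $n\ge1$. If the sequence $\left(\sum_{k=1}^nX_k\right)_{n\ge1}$ obeys a central limit theorem as $n\to\infty$, then so does the sequence $(R_n)_{n\ge1}$.
   Context: A sequence $(Y_n)_{n\ge1}$ of real random variables is said to obey a central limit theorem as $n\to\infty$ if there exist real constants $a_n$ and $b_n>0$ such that $(Y_n-a_n)/b_n$ converges in distribution to the standard normal distribution. The process $(R_n)$ is called the general uniformly reverting random walk. *)

(* Defs.v *)
From HB Require Import structures.
From mathcomp Require Export all_boot all_order all_algebra finmap.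
From mathcomp Require Export all_classical all_reals all_analysis.
Export Order.TTheory GRing.Theory Num.Theory.
Export numFieldNormedType.Exports.

Set Implicit Arguments.
Unset Strict Implicit.
Unset Printing Implicit Defensive.

Local Open Scope classical_set_scope.
Local Open Scope ring_scope.

(* Families of random variables are functions on nat, but the sequences of
   interest start at index 1: the predicates below only constrain the members
   whose index lies in the set D, and D is [set n | (1 <= n)%N] in the uses. *)

Section Independence.
Context d d' (T : measurableType d) (T' : measurableType d') (R : realType).
Variables (P : probability T R) (I : choiceType) (D : set I).

Definition mutually_independent (X : I -> {RV P >-> T'}) : Prop :=
  forall (J : {fset I}) (A : I -> set T'),
    [set` J] `<=` D ->
    (forall i, i \in J -> measurable (A i)) ->
    P (\bigcap_(i in [set` J]) X i @^-1` A i)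
      = (\prod_(i <- J) P (X i @^-1` A i))%E.

Definition identically_distributed (X : I -> {RV P >-> T'}) : Prop :=
  forall i j (A : set T'), D i -> D j -> measurable A ->
    distribution P (X i) A = distribution P (X j) A.

Definition generated_sigma_algebra (X : I -> {RV P >-> T'}) : set (set T) :=
  <<s \bigcup_(i in D) preimage_set_system setT (X i) measurable >>.

End Independence.

Definition independent_families d d1 d2 (T : measurableType d)
    (T1 : measurableType d1) (T2 : measurableType d2) (R : realType)
    (P : probability T R) (I : choiceType) (D : set I)
    (X : I -> {RV P >-> T1}) (Y : I -> {RV P >-> T2}) : Prop :=
  forall A B : set T, generated_sigma_algebra D X A ->
    generated_sigma_algebra D Y B -> P (A `&` B) = (P A * P B)%E.

Section Laws.
Context d (T : measurableType d) (R : realType) (P : probability T R).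

Definition uniform_on_1_to (n : nat) (V : {RV P >-> nat}) : Prop :=
  forall k : nat, distribution P V [set k]
    = (if (1 <= k <= n)%N then n%:R^-1 else 0)%:E.

(* P {Y n <= x} tends to mu ]-oo, x] at every continuity point x of the
   distribution function of mu; the Y n are measurable in all uses. *)
Definition converges_in_distribution (Y : nat -> T -> R)
    (mu : probability (measurableTypeR R) R) : Prop :=
  forall x : R, {for x, continuous (fun y : R => mu `]-oo, y]%classic)} ->
    P (Y n @^-1` `]-oo, x]%classic) @[n --> \oo] --> mu `]-oo, x]%classic.

Definition obeys_CLT (Y : nat -> T -> R) : Prop :=
  exists a b : nat -> R,
    (forall n, (1 <= n)%N -> 0 < b n) /\
    converges_in_distribution (fun n t => (Y n t - a n) / b n)
      (normal_prob (0 : R) 1).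

(* The uniform law only places V in {1, ..., n} almost surely, and the
   recursion is meaningless at points where U n lies outside {1, ..., n};
   hence the defining equations are required almost surely. *)
Definition uniformly_reverting_walk (U : nat -> {RV P >-> nat})
    (X W : nat -> {RV P >-> R}) : Prop :=
  {ae P, forall t, W 1%N t = 0} /\
  forall n, (1 <= n)%N -> {ae P, forall t, W n.+1 t = W (U n t) t + X n t}.

End Laws.

(* Main.v *)
From HB Require Import structures.
Require Import Defs.
From mathcomp Require Import measurable_realfun zify ring lra.

(** Write S_k = X_1 + ... + X_k, with distribution function F_k, and Phi for
    the standard normal distribution function.  Unrolling the recursion
    expresses R_n as the sum of the X_i over the chain of indices visited from
    n down to 1.  The length of that chain does not depend on the X_i, and
    R_(m+2) has length D + 1, where D is a sum of independent Bernoulli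
    variables of parameters 1/2, ..., 1/(m+1): the law of a number of records.
    Hence P (R_(m+2) <= z) = E F_(D+1)(z), which is [walk_cdf]; the expectation
    over D is the functional [record_mean m].

    The central limit theorem for S_k makes F_k uniformly close to
    Phi ((z - a_k) / b_k) by Polya's argument ([gauss_cdf_uniform_cvg]).  To
    mix over k one must know how a_k and b_k vary with k.  Since F_(m+j) is the
    convolution of F_m and F_j, it is also close to the normal distribution
    function with centre a_m + a_j and variance b_m^2 + b_j^2
    ([sum_cdf_add]), and convergence of types ([gauss_types]) shows that a and
    b^2 are additive up to errors o(b) and o(b^2) ([clt_approx_add]).
    Elementary arguments on such sequences give b_k / b_m -> 1 when k / m -> 1
    ([scale_ratio]), a growth bound b_m^8 >= c m^3 ([scale_growth]) and, as in
    the Hyers-Ulam theorem, a slope mu with a_m = m mu + o(b_m)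
    ([center_linear]).

    The mean h of D tends to infinity and its variance is at most h
    ([record_mean_sqr], [record_var_le]), so D concentrates near an integer q
    close to h, and F_(D+1)(z) may be replaced by Phi ((z - mu (D+1)) / b_q).
    This is the distribution function of b_q N + mu (D + 1), with N an
    independent standard normal variable.  Replacing the Bernoulli summands of
    D one at a time by normal ones costs at most 27 h (|mu| / b_q)^3 in all
    ([record_lindeberg]), which tends to 0 by the growth bound.  What remains
    is Phi ((z - mu (h+1)) / sqrt (b_q^2 + mu^2 Var D)), so the walk is
    asymptotically normal with these constants ([record_sum_limit]). *)

Set Implicit Arguments.
Unset Strict Implicit.
Unset Printing Implicit Defensive.

Local Open Scope classical_set_scope.
Local Open Scope ring_scope.

(** * Calculus of the standard normal distribution *)

Section StandardNormal.
Context {R : realType}.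
Implicit Types x y z a b : R.
Local Notation mu := (@lebesgue_measure R).

Definition gauss_density x : R := normal_pdf 0 1 x.
Definition gauss_cdf x : R := fine (normal_prob (0 : R) 1 `]-oo, x]).
Local Notation phi := gauss_density.
Local Notation Phi := gauss_cdf.

Lemma gauss_cdfE x : normal_prob (0 : R) 1 `]-oo, x] = (Phi x)%:E.
Proof. by rewrite /gauss_cdf fineK// fin_num_measure. Qed.

Lemma gauss_densityE x : phi x = normal_peak 1 * expR (- (x ^+ 2 / 2)).
Proof.
rewrite /gauss_density normal_pdfE ?oner_neq0// /normal_fun subr0 expr1n.
by rewrite mulNr mulr2n.
Qed.

Lemma gauss_density_gt0 x : 0 < phi x.
Proof. by rewrite gauss_densityE mulr_gt0 ?expR_gt0 ?normal_peak_gt0 ?oner_neq0. Qed.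

Lemma normal_peak1_le1 : normal_peak (1 : R) <= 1.
Proof.
have pi1 : 1 <= pi *+ 2 :> R by have := pi_ge2 R; rewrite mulr2n; lra.
have pi0 : 0 < pi *+ 2 :> R by apply: lt_le_trans pi1.
rewrite /normal_peak expr1n mul1r invf_le1; last by rewrite sqrtr_gt0; exact: pi0.
rewrite -[leLHS]sqrtr1 ler_sqrt; first exact: pi1.
exact: ltW pi0.
Qed.

(** With u = x^2 / 2 the inequality 1 + u^2 / 2 <= expR u gives x^4 expR (- u)
    <= 8; this single bound controls every polynomial factor of degree at most
    four below. *)
Lemma gauss_density_poly_le x : (1 + x ^+ 4) * phi x <= 9.
Proof.
have h : 1 + x ^+ 4 <= 9 * expR (x ^+ 2 / 2).
  have x2 : 0 <= x ^+ 2 / 2 by rewrite divr_ge0 ?sqr_ge0.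
  have := expR_ge1Dxn 1 x2; rewrite expr_div_n -exprM /=.
  have -> : (2`!%:R : R) = 2 by [].
  have : 0 <= x ^+ 4 by rewrite exprn_even_ge0.
  lra.
rewrite gauss_densityE expRN mulrCA (le_trans (y := 1 * 9))// ?mul1r//.
rewrite -[leRHS]mul1r ler_pM ?normal_peak_ge0 ?normal_peak1_le1//.
  by rewrite mulr_ge0 ?invr_ge0 ?expR_ge0 ?addr_ge0 ?exprn_even_ge0.
by rewrite ler_pdivrMr ?expR_gt0.
Qed.

Lemma gauss_density_bound x (P : R -> R) : `|P x| <= 1 + x ^+ 4 -> `|P x * phi x| <= 9.
Proof.
move=> h; rewrite normrM (gtr0_norm (gauss_density_gt0 x)).
by apply: le_trans (gauss_density_poly_le x); rewrite ler_pM2r ?gauss_density_gt0.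
Qed.

Lemma is_derive_gauss_cdf x : is_derive x 1 Phi (phi x).
Proof.
have x1 : x < x + 1 by rewrite ltrDl.
have int : mu.-integrable [set` Interval -oo%O (BRight (x + 1))] (EFin \o phi).
  by apply: integrableS (integrable_normal_pdf 0 1).
have [||d1 d2] := continuous_FTC1 x1 int; first exact: ltNyr.
  exact/continuous_normal_pdf/oner_neq0.
rewrite derive1E in d2.
exact: (DeriveDef d1 d2).
Qed.

Lemma is_derive_gauss_density x : is_derive x 1 phi (- x * phi x).
Proof.
rewrite (_ : phi = fun y => normal_peak 1 * expR (- (y ^+ 2 / 2))); last first.
  by apply/funext => y; exact: gauss_densityE.
have e : is_derive x 1 (fun y : R => - (y ^+ 2 / 2)) (- x).
  apply: is_derive_eq.
  by rewrite !scaler0 add0r /GRing.scale /= !mulr1; field.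
have e2 : is_derive x 1 (expR \o (fun y : R => - (y ^+ 2 / 2)))
    (- x * expR (- (x ^+ 2 / 2))).
  rewrite mulrC; apply: is_derive1_comp.
have := @is_deriveZ _ _ _ (expR \o (fun y : R => - (y ^+ 2 / 2))) (normal_peak 1) x 1 _ e2.
by move=> h; apply: is_derive_eq; rewrite /GRing.scale /= mulrCA.
Qed.

Lemma mvt_bound (f df : R -> R) a b (C : R) :
    (forall x, is_derive x 1 f (df x)) ->
    (forall x, Num.min a b <= x <= Num.max a b -> `|df x| <= C) ->
  `|f b - f a| <= C * `|b - a|.
Proof.
move=> fdf; wlog ab : a b / a <= b => [hw|].
  case/orP: (le_total a b) => ab; first exact: hw.
  by rewrite distrC [in leRHS]distrC minC maxC; exact: hw.
rewrite (min_idPl ab) (max_idPr ab) => dfC.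
have fc : {within `[a, b], continuous f}.
  apply: continuous_subspaceT => x; apply: differentiable_continuous.
  by apply/derivable1_diffP; case: (fdf x).
have [c cab ->] := MVT_segment ab (fun x _ => fdf x) fc.
by rewrite normrM ler_wpM2r// dfC// -(itvP cab).
Qed.

Lemma gauss_density_le9 x : `|phi x| <= 9.
Proof.
rewrite -[phi x]mul1r; apply: (@gauss_density_bound x (fun=> 1)).
by rewrite normr1 lerDl exprn_even_ge0.
Qed.

Lemma norm_le_poly4 x : `|x| <= 1 + x ^+ 4.
Proof.
have : 0 <= (x ^+ 2 - 2^-1) ^+ 2 by rewrite sqr_ge0.
have : 0 <= (x - 2^-1) ^+ 2 by rewrite sqr_ge0.
have : 0 <= (x + 2^-1) ^+ 2 by rewrite sqr_ge0.
by rewrite ler_norml => *; apply/andP; split; nra.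
Qed.

Lemma gauss_density_x_le x : `|x * phi x| <= 9.
Proof. exact: (@gauss_density_bound x id) (norm_le_poly4 x). Qed.

Lemma gauss_cdf_lipschitz x y : `|Phi y - Phi x| <= 9 * `|y - x|.
Proof.
apply: (mvt_bound is_derive_gauss_cdf) => z _; exact: gauss_density_le9.
Qed.

Lemma continuous_gauss_cdf : continuous Phi.
Proof.
move=> x; apply: differentiable_continuous; apply/derivable1_diffP.
by case: (is_derive_gauss_cdf x).
Qed.

Lemma gauss_cdf_lt x y : x < y -> Phi x < Phi y.
Proof.
move=> xy.
have fc : {within `[x, y], continuous Phi}.
  exact/continuous_subspaceT/continuous_gauss_cdf.
have [c _ h] := MVT xy (fun x _ => is_derive_gauss_cdf x) fc.
by rewrite -subr_gt0 h mulr_gt0 ?gauss_density_gt0// subr_gt0.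
Qed.

Lemma gauss_cdf_le x y : x <= y -> Phi x <= Phi y.
Proof. by rewrite le_eqVlt => /predU1P[->//|/gauss_cdf_lt/ltW]. Qed.

Lemma gauss_cdf_ge0 x : 0 <= Phi x.
Proof. by rewrite /gauss_cdf fine_ge0. Qed.

Lemma gauss_cdf_le1 x : Phi x <= 1.
Proof. by rewrite -lee_fin -gauss_cdfE probability_le1. Qed.

Lemma between_scaled_norm (r : R) x z : 2^-1 <= r ->
  Num.min x (r * x) <= z <= Num.max x (r * x) -> `|x| <= 2 * `|z|.
Proof.
move=> r2 /andP[].
have [x0|x0] := leP 0 x.
  rewrite ge_min le_max => /orP z1 /orP z2.
  have z0 : 0 <= z by case: z1 => z1; nra.
  by rewrite ger0_norm// (ger0_norm z0); case: z1 => z1; nra.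
rewrite ge_min le_max => /orP z1 /orP z2.
have z0 : z <= 0 by case: z2 => z2; nra.
by rewrite ltr0_norm// (ler0_norm z0); case: z2 => z2; nra.
Qed.

(** The increment is x phi z (r - 1) with z between x and r x, where |x| <= 2
    |z|, and z phi z is bounded. *)
Lemma gauss_cdf_scale (r : R) x : 2^-1 <= r -> `|Phi (r * x) - Phi x| <= 18 * `|r - 1|.
Proof.
move=> r2; have [->|x0] := eqVneq x 0; first by rewrite mulr0 subrr normr0 mulr_ge0.
have nx : 0 < `|x| by rewrite normr_gt0.
rewrite (_ : 18 * `|r - 1| = 18 / `|x| * `|r * x - x|); last first.
  by rewrite -{3}[x]mul1r -mulrBl normrM; field; rewrite gt_eqF.
apply: (mvt_bound is_derive_gauss_cdf) => z /(between_scaled_norm r2) xz.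
rewrite ler_pdivlMr// mulrC (le_trans (ler_wpM2r (normr_ge0 _) xz))//.
by rewrite -mulrA -normrM; have := gauss_density_x_le z; lra.
Qed.

Lemma is_derive_shiftr (f : R -> R) (df x t : R) :
  is_derive (x + t) 1 f df -> is_derive t 1 (fun t => f (x + t)) df.
Proof.
move=> h; have h2 : is_derive t 1 (fun t : R => x + t) 1.
  rewrite (_ : (fun _ => _) = shift x); first exact: is_derive_shift.
  by apply/funext => u; rewrite /= addrC.
by have := @is_derive1_comp _ f (fun t => x + t) t _ _ h h2; rewrite mulr1.
Qed.

Lemma is_derive_x_gauss_density x :
  is_derive x 1 (fun x => x * phi x) ((1 - x ^+ 2) * phi x).
Proof.
have := is_derive_gauss_density x => h.
by apply: is_derive_eq; rewrite /GRing.scale /=; ring.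
Qed.

Lemma between0_norm (d t : R) : Num.min 0 d <= t <= Num.max 0 d -> `|t| <= `|d|.
Proof.
by have [d0|d0] := leP 0 d => /andP[t0 td];
  [rewrite !ger0_norm|rewrite (ltr0_norm d0) ler0_norm// lerN2].
Qed.

(** The derivative in d of the remainder is a difference of values of x phi x,
    a function with bounded derivative (1 - x^2) phi x. *)
Lemma gauss_density_taylor x (d : R) :
  `|phi (x + d) - phi x + d * (x * phi x)| <= 9 * `|d| ^+ 2.
Proof.
pose g (t : R) : R := phi (x + t) + t * (x * phi x).
have dg (t : R) : is_derive t 1 g (- ((x + t) * phi (x + t) - x * phi x)).
  have h := is_derive_shiftr (is_derive_gauss_density (x + t)).
  by apply: is_derive_eq; rewrite /GRing.scale /=; ring.
have := @mvt_bound g _ 0 d (9 * `|d|) dg; rewrite /g addr0 mul0r addr0 subr0.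
rewrite addrAC -mulrA -expr2; apply => t /between0_norm td.
rewrite normrN (le_trans (y := 9 * `|x + t - x|))//; last first.
  by rewrite addrAC subrr add0r ler_wpM2l.
apply: (mvt_bound is_derive_x_gauss_density) => z _.
apply: (@gauss_density_bound z (fun z => 1 - z ^+ 2)).
have : 0 <= z ^+ 2 by rewrite sqr_ge0.
have : 0 <= (z ^+ 2 - 1) ^+ 2 by rewrite sqr_ge0.
by rewrite ler_norml => *; apply/andP; split; nra.
Qed.

Lemma gauss_cdf_taylor x (d : R) :
  `|Phi (x + d) - Phi x - d * phi x + d ^+ 2 / 2 * (x * phi x)| <= 9 * `|d| ^+ 3.
Proof.
pose g (t : R) : R := Phi (x + t) - t * phi x + t ^+ 2 / 2 * (x * phi x).
have dg (t : R) : is_derive t 1 g (phi (x + t) - phi x + t * (x * phi x)).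
  have h := is_derive_shiftr (is_derive_gauss_cdf (x + t)).
  by apply: is_derive_eq; rewrite !scaler0 /GRing.scale /=; field.
have := @mvt_bound g _ 0 d (9 * `|d| ^+ 2) dg.
rewrite subr0 -(mulrA 9) -exprSr /g addr0 mul0r expr0n/= !mul0r addr0 !subr0 => h.
rewrite (_ : _ + _ = Phi (x + d) - d * phi x + d ^+ 2 / 2 * (x * phi x) - Phi x);
  last by ring.
apply: h => t /between0_norm td; apply: le_trans (gauss_density_taylor x t) _.
by rewrite ler_wpM2l// lerXn2r ?nnegrE.
Qed.

Lemma norm_cube_le_poly4 x : `|x ^+ 3| <= 1 + x ^+ 4.
Proof.
have : 0 <= (x ^+ 2 - x) ^+ 2 by rewrite sqr_ge0.
have : 0 <= (x ^+ 2 + x) ^+ 2 by rewrite sqr_ge0.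
have : 0 <= (x ^+ 2 - 1) ^+ 2 by rewrite sqr_ge0.
by rewrite ler_norml => *; apply/andP; split; nra.
Qed.

Lemma between_trans (a b z w : R) :
    Num.min a b <= z <= Num.max a b -> Num.min a z <= w <= Num.max a z ->
  Num.min a b <= w <= Num.max a b.
Proof.
case: (leP a b) => ab /andP[z1 z2].
  by rewrite (min_idPl z1) (max_idPr z1) => /andP[-> /le_trans->].
by rewrite (min_idPr z2) (max_idPl z2) => /andP[/(le_trans z1)-> ->].
Qed.

Lemma between_dist (a b z : R) :
  Num.min a b <= z <= Num.max a b -> `|z - a| <= `|b - a|.
Proof.
case: (leP a b) => ab /andP[z1 z2]; first by rewrite !ger0_norm; lra.
by rewrite distrC (distrC b) !ger0_norm; lra.
Qed.

(** Multiplying x by r = (1 + e)^(-1/2) amounts to adding variance e, and the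
    heat equation predicts the first-order change e / 2 * Phi'' x, where Phi''
    x = - x phi x. The displacement (r - 1) x is not bounded, but the
    remainder is of order x^2 |Phi'' z| e^2 with z between x and r x, and
    there |x| <= 2 |z|. *)
Lemma gauss_cdf_shrink (r e : R) x : 0 <= e -> e <= 1 -> 0 < r ->
    r ^+ 2 * (1 + e) = 1 ->
  `|Phi (r * x) - Phi x + e / 2 * (x * phi x)| <= 18 * e ^+ 2.
Proof.
move=> e0 e1 r0 re.
have r2 : 2^-1 <= r by rewrite leNgt; apply/negP => h; nra.
have r1 : r <= 1 by rewrite leNgt; apply/negP => h; nra.
(* Second-order expansion of r = (1 + e)^(-1/2): it lies between 1 - e / 2 and
   1 - e / 2 + e^2. *)
have rlow : 1 - r <= e / 2.
  rewrite leNgt; apply/negP => h.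
  have h1 : r ^+ 2 < (1 - e / 2) ^+ 2 by rewrite ltrXn2r ?nnegrE//=; lra.
  have : r ^+ 2 * (1 + e) < (1 - e / 2) ^+ 2 * (1 + e) by rewrite ltr_pM2r//; lra.
  rewrite re; nra.
have rup : r - 1 + e / 2 <= e ^+ 2.
  rewrite leNgt; apply/negP => h.
  have h0 : 0 < 1 - e / 2 + e ^+ 2 by nra.
  have h1 : (1 - e / 2 + e ^+ 2) ^+ 2 < r ^+ 2.
    by rewrite ltrXn2r ?nnegrE//=; lra.
  have h2 : (1 - e / 2 + e ^+ 2) ^+ 2 * (1 + e) < r ^+ 2 * (1 + e).
    by rewrite ltr_pM2r//; lra.
  have : 1 <= (1 - e / 2 + e ^+ 2) ^+ 2 * (1 + e).
    have -> : (1 - e / 2 + e ^+ 2) ^+ 2 * (1 + e) =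
      1 + e ^+ 2 * (5 / 4 + e * (5 / 4)+ e ^+ 3) by field.
    by rewrite lerDl mulr_ge0 ?sqr_ge0// !addr_ge0// ?mulr_ge0 ?exprn_ge0.
  by rewrite leNgt -[X in _ < X]re h2.
have [->|x0] := eqVneq x 0.
  by rewrite mulr0 subrr add0r mul0r mulr0 normr0 mulr_ge0// sqr_ge0.
have x2 : 0 < x ^+ 2 by rewrite exprn_even_gt0.
have main : `|Phi (r * x) - Phi x - (r * x - x) * phi x| <= 9 * e ^+ 2.
  pose g (z : R) : R := Phi z - z * phi x.
  have dg (z : R) : is_derive z 1 g (phi z - phi x).
    have h := is_derive_gauss_cdf z.
    by apply: is_derive_eq; rewrite /GRing.scale /=; ring.
  rewrite (_ : _ - _ = g (r * x) - g x); last by rewrite /g; ring.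
  rewrite (le_trans (y := 36 / x ^+ 2 * `|r * x - x| * `|r * x - x|))//.
    apply: (mvt_bound dg) => z xz.
    rewrite (le_trans (y := 36 / x ^+ 2 * `|z - x|))//.
      apply: (mvt_bound is_derive_gauss_density) => w wxz.
      have : `|x| <= 2 * `|w|.
        exact: (between_scaled_norm r2) (between_trans xz wxz).
      rewrite -(ler_sqr (y := _ * _)) ?nnegrE ?mulr_ge0// exprMn !real_normK ?num_real// => xw.
      rewrite ler_pdivlMr// mulNr normrN.
      rewrite (le_trans (y := `|w * phi w| * (2 ^+ 2 * w ^+ 2)))//.
        by rewrite ler_wpM2l.
      rewrite -[X in _ * X](ger0_norm (_ : 0 <= 2 ^+ 2 * w ^+ 2)); last first.
        by rewrite mulr_ge0// sqr_ge0.
      rewrite -normrM (_ : w * phi w * (2 ^+ 2 * w ^+ 2) = 4 * (w ^+ 3 * phi w)); last by ring.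
      rewrite normrM ger0_norm//.
      have := @gauss_density_bound w (fun w => w ^+ 3) (norm_cube_le_poly4 w); lra.
    apply: ler_wpM2l; first by rewrite divr_ge0// ltW.
    exact: between_dist.
  rewrite -mulrA -expr2 real_normK ?num_real//.
  rewrite (_ : 36 / x ^+ 2 * (r * x - x) ^+ 2 = 36 * (1 - r) ^+ 2); last first.
    by field.
  have : (1 - r) ^+ 2 <= (e / 2) ^+ 2 by rewrite lerXn2r ?nnegrE//=; lra.
  by rewrite expr_div_n; lra.
rewrite (_ : _ + _ = Phi (r * x) - Phi x - (r * x - x) * phi x
    + (r - 1 + e / 2) * (x * phi x)); last by ring.
apply: le_trans (ler_normD _ _) _; rewrite normrM.
have h1 := gauss_density_x_le x.
have h2 : `|r - 1 + e / 2| <= e ^+ 2 by rewrite ger0_norm//; lra.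
have : `|r - 1 + e / 2| * `|x * phi x| <= e ^+ 2 * 9 by rewrite ler_pM.
lra.
Qed.

(** Averaging Phi over the centred two-point variable with values p d and - (1
    - p) d matches adding an independent normal variable of the same variance
    p (1 - p) d^2: first and second order terms agree, and the third order
    ones are at most a multiple of p |d|^3. *)
Lemma bernoulli_gauss_step (p d r : R) x : 0 <= p -> p <= 1 -> `|d| <= 1 ->
    0 < r -> r ^+ 2 * (1 + p * (1 - p) * d ^+ 2) = 1 ->
  `|(1 - p) * Phi (x + p * d) + p * Phi (x - (1 - p) * d) - Phi (r * x)|
    <= 27 * p * `|d| ^+ 3.
Proof.
move=> p0 p1 d1 r0 re.
have d2 : d ^+ 2 <= 1 by rewrite -real_normK ?num_real// expr_le1.
have d20 : 0 <= d ^+ 2 by rewrite sqr_ge0.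
have pp : 0 <= p * (1 - p) by rewrite mulr_ge0//; lra.
have pp1 : p * (1 - p) <= p by nra.
set h := p * (1 - p) * d ^+ 2 in re.
have h0 : 0 <= h by rewrite mulr_ge0.
have h1 : h <= 1 by rewrite /h; nra.
have T1 := gauss_cdf_taylor x (p * d).
have T2 := gauss_cdf_taylor x (- ((1 - p) * d)).
have T3 := gauss_cdf_shrink x h0 h1 r0 re.
set A := (X in `|X| <= _) in T1; set B := (X in `|X| <= _) in T2.
set C := (X in `|X| <= _) in T3.
rewrite (_ : _ - _ = (1 - p) * A + p * B - C); last first.
  by rewrite /A /B /C /h; field.
have q0 : 0 <= 1 - p by lra.
apply: le_trans (ler_normB _ _) _; apply: le_trans (lerD (ler_normD _ _) T3) _.
rewrite 2!normrM (ger0_norm p0) (ger0_norm q0).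
have D3 : 0 <= `|d| ^+ 3 by rewrite exprn_ge0.
have T1' : (1 - p) * `|A| <= (1 - p) * (9 * (p ^+ 3 * `|d| ^+ 3)).
  by rewrite ler_wpM2l// (le_trans T1)// normrM exprMn (ger0_norm p0).
have T2' : p * `|B| <= p * (9 * ((1 - p) ^+ 3 * `|d| ^+ 3)).
  by rewrite ler_wpM2l// (le_trans T2)// normrN normrM exprMn (ger0_norm q0).
have T3' : 18 * h ^+ 2 <= 18 * (p * `|d| ^+ 3).
  rewrite ler_wpM2l// /h exprMn -exprM -[d ^+ (2 * 2)]ger0_norm ?exprn_even_ge0//.
  rewrite normrX ler_pM ?sqr_ge0 ?exprn_ge0//.
    by apply: (le_trans (y := p * p)); [rewrite expr2 ler_pM|rewrite ler_piMl].
  by rewrite exprS ler_piMl.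
have : (1 - p) * (9 * (p ^+ 3 * `|d| ^+ 3)) + p * (9 * ((1 - p) ^+ 3 * `|d| ^+ 3))
   <= 9 * p * `|d| ^+ 3.
  rewrite (_ : _ + _ = 9 * (p * (1 - p) * (p ^+ 2 + (1 - p) ^+ 2)) * `|d| ^+ 3); last by ring.
  rewrite ler_wpM2r// ler_wpM2l//.
  have : p ^+ 2 + (1 - p) ^+ 2 <= 1 by nra.
  have : 0 <= p ^+ 2 + (1 - p) ^+ 2 by rewrite addr_ge0 ?sqr_ge0.
  nra.
lra.
Qed.
End StandardNormal.

Section NormalLaws.
Context {R : realType}.
Implicit Types x y z a b : R.
Local Notation mu := (@lebesgue_measure R).
Local Notation phi := gauss_density.
Local Notation Phi := gauss_cdf.

Lemma normal_pdf_gauss a b x : 0 < b -> normal_pdf a b x = phi ((x - a) / b) / b.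
Proof.
move=> b0; rewrite gauss_densityE normal_pdfE ?gt_eqF// mulrAC; congr (_ * _).
  rewrite /normal_peak expr1n mul1r -mulrnAr sqrtrM ?sqr_ge0// sqrtr_sqr gtr0_norm//.
  by rewrite invfM mulrC.
by rewrite /normal_fun; congr expR; field; rewrite gt_eqF.
Qed.

Lemma normal_prob_gauss a b y : 0 < b ->
  normal_prob a b `]-oo, y] = (Phi ((y - a) / b))%:E.
Proof.
move=> b0; rewrite -gauss_cdfE /normal_prob.
have dF x : is_derive x 1 (fun x : R => (x - a) / b) b^-1.
  by apply: is_derive_eq; rewrite !scaler0 add0r subr0 /GRing.scale /= mulr1.
have F'E : (fun x : R => (x - a) / b)^`()%classic = cst b^-1.
  by apply/funext => x; rewrite derive1E; have [_ ->] := dF x.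
have Fc : continuous (fun x : R => (x - a) / b).
  move=> x; apply: differentiable_continuous; apply/derivable1_diffP.
  by case: (dF x).
rewrite (@increasing_ge0_integration_by_substitutionNy _ (fun x => (x - a) / b) phi y).
- by apply: eq_integral => x _; rewrite normal_pdf_gauss// F'E.
- by move=> u v _ _ uv; rewrite ltr_pM2r ?invr_gt0// ltrD2r.
- by move=> x _; rewrite F'E; exact: cst_continuous.
- by rewrite F'E; exact: is_cvg_cst.
- by rewrite F'E; exact: cvg_cst.
- split; first by move=> x _; case: (dF x).
  exact/cvg_at_left_filter/Fc.
- apply/gt0_cvgMlNy; first by rewrite invr_gt0.
  exact: cvg_addrr_Ny.
- by apply: continuous_subspaceT; exact/continuous_normal_pdf/oner_neq0.
- by move=> x _; exact: normal_pdf_ge0.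
Qed.

(** The Radon-Nikodym derivative of [normal_prob a b] is its density. *)
Lemma integral_normal_prob a b (f : R -> R) : 0 < b ->
    measurable_fun setT f -> (forall x, 0 <= f x <= 1) ->
  (\int[normal_prob a b]_x (f x)%:E =
   \int[mu]_x ((f x)%:E * (normal_pdf a b x)%:E))%E.
Proof.
move=> b0 mf f01.
have fint : (normal_prob a b).-integrable setT (EFin \o f).
  apply: measurable_bounded_integrable => //.
    by rewrite (le_lt_trans (probability_le1 _ _)) ?ltry.
  exists 1; split; first exact: num_real.
  move=> M M1 x _ /=; rewrite ger0_norm; last by case/andP: (f01 x).
  by rewrite (le_trans _ (ltW M1))//; case/andP: (f01 x).
rewrite -(Radon_Nikodym_change_of_variables (normal_prob_dominates a b))//=.
have mfE : measurable_fun [set: R] (EFin \o f) by exact/measurable_EFinP.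
have mpdf : measurable_fun [set: R] (fun x : R => (normal_pdf a b x)%:E).
  by apply/measurable_EFinP; exact: measurable_normal_pdf.
apply: ae_eq_integral => //.
- apply: emeasurable_funM => //; apply: (measurable_int mu).
  by apply: Radon_Nikodym_integrable; exact: normal_prob_dominates.
- exact: emeasurable_funM.
- apply: ae_eqe_mul2l => /=; apply: integral_ae_eq => //=.
    by apply: Radon_Nikodym_integrable; exact: normal_prob_dominates.
  by move=> E ES mE; rewrite -Radon_Nikodym_integral//=; exact: normal_prob_dominates.
Qed.

(** Completing the square in z: the joint density of a normal variable and of
    a normal variable centred at it, up to a shift by a', is the marginal
    density of the second one times the conditional density of the first. *)
Lemma normal_pdf_mul a b a' b' z u : 0 < b -> 0 < b' ->
  let s := Num.sqrt (b ^+ 2 + b' ^+ 2) in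
  normal_pdf (z + a') b' u * normal_pdf a b z =
  normal_pdf (a + a') s u *
    normal_pdf ((a * b' ^+ 2 + (u - a') * b ^+ 2) / s ^+ 2) (b * b' / s) z.
Proof.
move=> b0 b'0 s.
have s2 : s ^+ 2 = b ^+ 2 + b' ^+ 2 by rewrite sqr_sqrtr// addr_ge0// sqr_ge0.
have s0 : 0 < s by rewrite sqrtr_gt0 addr_gt0// exprn_gt0.
have sn0 : b ^+ 2 + b' ^+ 2 != 0 by rewrite -s2 gt_eqF// exprn_gt0.
rewrite !normal_pdf_gauss ?divr_gt0 ?mulr_gt0// !gauss_densityE.
set p := normal_peak _.
have E (A B x y r t : R) : x + y = r + t -> A = B ->
   A * (expR (- (x / 2)) * expR (- (y / 2))) = B * (expR (- (r / 2)) * expR (- (t / 2))).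
  by move=> h ->; rewrite -!expRD -!opprD -!mulrDl h.
transitivity (p * p / (b * b') * (expR (- (((u - (z + a')) / b') ^+ 2 / 2)) *
   expR (- (((z - a) / b) ^+ 2 / 2)))).
  by field; rewrite !gt_eqF.
rewrite (E _ (p * p / (b * b')) _ _ (((u - (a + a')) / s) ^+ 2)
  (((z - (a * b' ^+ 2 + (u - a') * b ^+ 2) / s ^+ 2) / (b * b' / s)) ^+ 2) _ erefl);
  last first.
  rewrite !expr_div_n !exprMn s2.
  by field; rewrite sn0 !gt_eqF.
by field; rewrite !gt_eqF.
Qed.

(** Sums of independent normal variables are normal. By Tonelli the inner
    integral over z is that of a normal density, by [normal_pdf_mul]. *)
Lemma gauss_conv a b a' b' y : 0 < b -> 0 < b' ->
  (\int[normal_prob a b]_z (Phi ((y - z - a') / b'))%:E =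
   (Phi ((y - a - a') / Num.sqrt (b ^+ 2 + b' ^+ 2)))%:E)%E.
Proof.
move=> b0 b'0; set s := Num.sqrt _.
have s0 : 0 < s by rewrite sqrtr_gt0 addr_gt0// exprn_gt0.
have mphi : measurable_fun setT (phi : R -> R) by exact: measurable_normal_pdf.
have mPhi : measurable_fun setT (Phi : R -> R).
  by apply: continuous_measurable_fun; exact: continuous_gauss_cdf.
rewrite integral_normal_prob//; last 2 first.
- apply: measurableT_comp => //; apply: measurable_funM => //.
  by apply: measurable_funB => //; exact: measurable_funB.
- by move=> x; rewrite gauss_cdf_ge0 gauss_cdf_le1.
pose f (p : R * R) : \bar R := (normal_pdf (p.1 + a') b' p.2 *
   normal_pdf a b p.1 * \1_(`]-oo, y]%classic) p.2)%:E.
have mf : measurable_fun setT f.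
  apply/measurable_EFinP/measurable_funM; last first.
    exact: measurableT_comp.
  apply: measurable_funM; last first.
    by apply: measurableT_comp => //; exact: measurable_normal_pdf.
  under eq_fun do rewrite normal_pdf_gauss//.
  apply: measurable_funM => //; apply: measurableT_comp => //.
  by apply: measurable_funM => //; apply: measurable_funB => //; exact: measurable_funD.
have f0 p : (0 <= f p)%E by rewrite lee_fin !mulr_ge0 ?normal_pdf_ge0.
transitivity (\int[mu]_z \int[mu]_u f (z, u))%E.
  apply: eq_integral => z _.
  rewrite (_ : y - z - a' = y - (z + a')); last by ring.
  rewrite -normal_prob_gauss// /normal_prob muleC -ge0_integralZl//; last 3 first.
  - by apply/measurable_EFinP/measurable_funTS; exact: measurable_normal_pdf.
  - by move=> u _; rewrite lee_fin normal_pdf_ge0.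
  - by rewrite lee_fin normal_pdf_ge0.
  rewrite integral_mkcond; apply: eq_integral => u _.
  rewrite /f /= patchE indicE; case: ifP => /= _; last by rewrite mulr0.
  by rewrite mulr1 -EFinM mulrC.
apply: (etrans (@fubini_tonelli _ _ _ _ _ mu mu f mf f0)).
transitivity (\int[mu]_(u in `]-oo, y]) (normal_pdf (a + a') s u)%:E)%E; last first.
  rewrite (_ : y - a - a' = y - (a + a')); last by ring.
  by rewrite -normal_prob_gauss.
rewrite [RHS]integral_mkcond; apply: eq_integral => u _.
rewrite /f /= patchE indicE; case: ifP => /= _; last first.
  by under eq_integral do rewrite mulr0; rewrite integral0.
under eq_integral do rewrite mulr1 normal_pdf_mul// -/s EFinM.
rewrite ge0_integralZl//; last 3 first.
- by apply/measurable_EFinP; exact: measurable_normal_pdf.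
- by move=> z _; rewrite lee_fin normal_pdf_ge0.
- by rewrite lee_fin normal_pdf_ge0.
by rewrite integral_normal_pdf mule1.
Qed.

Let idR : measurableTypeR R -> R := idfun.

#[local] HB.instance Definition _ :=
  @isMeasurableFun.Build _ _ _ _ idR (@measurable_id _ _ setT).

Lemma gauss_cdf_cvgy : Phi x @[x --> +oo] --> (1 : R).
Proof.
have := @cvg_cdfy1 _ _ _ (normal_prob (0 : R) 1) idR.
rewrite (_ : cdf _ = EFin \o Phi); last first.
  by apply/funext => x; rewrite /cdf /= -gauss_cdfE.
by move/fine_cvgP => [].
Qed.

Lemma gauss_cdf_cvgNy : Phi x @[x --> -oo] --> (0 : R).
Proof.
have := @cvg_cdfNy0 _ _ _ (normal_prob (0 : R) 1) idR.
rewrite (_ : cdf _ = EFin \o Phi); last first.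
  by apply/funext => x; rewrite /cdf /= -gauss_cdfE.
by move/fine_cvgP => [].
Qed.
End NormalLaws.

(** * Averaging a function over random shifts *)

Section ShiftAverage.
Context {R : realType}.

(** The convolutions below are only applied to functions with values in [0,
    1]; this makes every integral finite and lets Tonelli apply. *)
Definition test_function (f : R -> R) : Prop :=
  measurable_fun setT f /\ forall y, 0 <= f y <= 1.

(** Convolution with the law of X, written as an expectation so that no image
    measure is needed: if f is a distribution function, this is the
    distribution function of the sum of X and an independent variable. *)
Definition shift_average d (T : measurableType d) (P : probability T R)
  (X : T -> R) (f : R -> R) (y : R) : R := (\int[P]_t f (y - X t))%R.

Lemma test_convex (p : R) (f g : R -> R) : 0 <= p -> p <= 1 -> test_function f -> test_function g ->
  test_function (fun y => (1 - p) * f y + p * g y).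
Proof.
move=> p0 p1 [mf f01] [mg g01]; split.
  by apply: measurable_funD; apply: measurable_funM.
move=> y; have /andP[a0 a1] := f01 y; have /andP[c0 c1] := g01 y.
by apply/andP; split; nra.
Qed.

Section OneVariable.
Context d (T : measurableType d) (P : probability T R) (X : T -> R).
Hypothesis mX : measurable_fun setT X.
Implicit Types f g : R -> R.
Local Notation avg := (shift_average P X).

Lemma test_measurable f y : test_function f -> measurable_fun setT (fun t => f (y - X t)).
Proof. by move=> [mf _]; apply: measurableT_comp => //; exact: measurable_funB. Qed.

Lemma test_integrable f y : test_function f ->
  P.-integrable setT (EFin \o (fun t => f (y - X t))).
Proof.
move=> tf; apply: measurable_bounded_integrable => //.
- by rewrite (le_lt_trans (probability_le1 _ _)) ?ltry.
- exact: test_measurable.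
exists 1; split; first exact: num_real.
move=> M M1 t _ /=; have /andP[f0 f1] := tf.2 (y - X t).
by rewrite ger0_norm// (le_trans f1)// ltW.
Qed.

Lemma shift_averageE f y : test_function f ->
  (avg f y)%:E = (\int[P]_t (f (y - X t))%:E)%E.
Proof.
move=> tf; rewrite /shift_average /Rintegral fineK//.
by apply: integrable_fin_num => //; exact: test_integrable.
Qed.

Lemma shift_average_ext f g : f =1 g -> avg f =1 avg g.
Proof. by move=> fg y; apply: eq_Rintegral => t _; exact: fg. Qed.

Lemma shift_average_dist f g (e : R) : test_function f -> test_function g ->
  (forall y, `|f y - g y| <= e) -> forall y, `|avg f y - avg g y| <= e.
Proof.
move=> tf tg h y.
have mf := test_integrable y tf; have mg := test_integrable y tg.
rewrite /shift_average -RintegralB//.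
have mfg : P.-integrable setT (EFin \o (fun t => f (y - X t) - g (y - X t))).
  exact: (integrableB measurableT mf mg).
apply: le_trans (le_normr_Rintegral _ _) _ => //.
apply: (le_trans (y := (\int[P]_t e)%R)); last first.
  by rewrite Rintegral_cst//= probability_setT mulr1.
apply: le_Rintegral => //.
- exact: integrable_norm.
- by apply: finite_measure_integrable_cst.
Qed.

Lemma shift_average_convex f g (r s : R) : test_function f -> test_function g ->
  forall y, avg (fun u => r * f u + s * g u) y = r * avg f y + s * avg g y.
Proof.
move=> tf tg y; have mf := test_integrable y tf; have mg := test_integrable y tg.
have mrf : P.-integrable setT (EFin \o (fun t => r * f (y - X t))).
  exact: (integrableZl measurableT r mf).
have msg : P.-integrable setT (EFin \o (fun t => s * g (y - X t))).
  exact: (integrableZl measurableT s mg).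
by rewrite /shift_average RintegralD// !RintegralZl.
Qed.

Lemma shift_average_test f : test_function f -> test_function (avg f).
Proof.
move=> tf; split; last first.
  move=> y; rewrite -!lee_fin shift_averageE//; apply/andP; split.
    by apply: integral_ge0 => t _; rewrite lee_fin; case/andP: (tf.2 (y - X t)).
  rewrite -(@probability_setT _ _ _ P) -[leRHS]mul1e -integral_cst//.
  apply: ge0_le_integral => //.
  - by move=> t _; rewrite lee_fin; case/andP: (tf.2 (y - X t)).
  - by apply/measurable_EFinP; exact: test_measurable.
  - by move=> t _; rewrite lee_fin; case/andP: (tf.2 (y - X t)).
apply/measurable_EFinP.
rewrite (_ : _ \o _ = fubini_F P (fun p : R * T => (f (p.1 - X p.2))%:E)); last first.
  by apply/funext => y; rewrite /= shift_averageE.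
apply: measurable_fun_fubini_tonelli_F; last first.
  by move=> p; rewrite lee_fin; case/andP: (tf.2 (p.1 - X p.2)).
apply/measurable_EFinP; apply: measurableT_comp; first exact: tf.1.
by apply: measurable_funB => //; exact: measurableT_comp.
Qed.

Lemma test_iter f n : test_function f -> test_function (iter n avg f).
Proof. by move=> tf; elim: n => // n; exact: shift_average_test. Qed.

Lemma iter_dist f g (e : R) n : test_function f -> test_function g ->
  (forall y, `|f y - g y| <= e) -> forall y, `|iter n avg f y - iter n avg g y| <= e.
Proof.
move=> tf tg h; elim: n => // n IH y /=.
by apply: shift_average_dist => //; exact: test_iter.
Qed.
End OneVariable.

(** Both sides integrate f (y - X1 - X2) over the product space. *)
Lemma shift_average_comm d1 (T1 : measurableType d1) (P1 : probability T1 R)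
    (X1 : T1 -> R) d2 (T2 : measurableType d2) (P2 : probability T2 R) (X2 : T2 -> R)
    (f : R -> R) :
    measurable_fun setT X1 -> measurable_fun setT X2 -> test_function f ->
  shift_average P1 X1 (shift_average P2 X2 f) =1
  shift_average P2 X2 (shift_average P1 X1 f).
Proof.
move=> m1 m2 tf y; apply: EFin_inj.
rewrite !shift_averageE//; try exact: shift_average_test.
under eq_integral do rewrite shift_averageE//.
under [RHS]eq_integral do rewrite shift_averageE//.
rewrite (fubini_tonelli (fun p : T1 * T2 => (f (y - X1 p.1 - X2 p.2))%:E))/=.
- by apply: eq_integral => t2 _; apply: eq_integral => t1 _; rewrite addrAC.
- apply/measurable_EFinP; apply: measurableT_comp; first exact: tf.1.
  apply: measurable_funB; last exact: measurableT_comp.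
  by apply: measurable_funB => //; exact: measurableT_comp.
- by move=> p; rewrite lee_fin; case/andP: (tf.2 (y - X1 p.1 - X2 p.2)).
Qed.

Definition heaviside (y : R) : R := ((0 <= y)%R : bool)%:R.

Lemma heaviside_test : test_function heaviside.
Proof.
split; last by move=> y; rewrite /heaviside; case: (0 <= y)%R; rewrite ?lexx ?ler01.
rewrite (_ : heaviside = \1_`[0, +oo[%classic); first exact: measurable_indic.
apply/funext => y; rewrite indicE /heaviside; congr (_%:R); congr nat_of_bool.
by apply/idP/idP; rewrite inE /= in_itv/= andbT.
Qed.

Lemma shift_average_heaviside d (T : measurableType d) (P : probability T R) (X : T -> R) y :
  measurable_fun setT X ->
  (shift_average P X heaviside y)%:E = P (X @^-1` `]-oo, y]).
Proof.
move=> mX; rewrite shift_averageE//; last exact: heaviside_test.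
have mA : measurable (X @^-1` `]-oo, y]) by rewrite -[X in measurable X]setTI; exact: mX.
rewrite -[X in P X](setIT) -integral_indic//; apply: eq_integral => t _.
congr EFin; rewrite indicE /heaviside subr_ge0; congr (_%:R); congr nat_of_bool.
by apply/idP/idP; rewrite inE /= in_itv.
Qed.

Section GaussAverage.

(** Convolution with a normal law, seen as the law of the identity
    variable. *)
Definition gauss_average (a b : R) : (R -> R) -> (R -> R) :=
  shift_average (normal_prob a b) (idfun : measurableTypeR R -> R).
Local Notation Phi := gauss_cdf.

Lemma measurable_idR : measurable_fun setT (idfun : measurableTypeR R -> R).
Proof. exact: measurable_id. Qed.

Definition affine_gauss_cdf (a b y : R) : R := Phi ((y - a) / b).

Lemma affine_gauss_test a b : test_function (affine_gauss_cdf a b).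
Proof.
split; last by move=> y; rewrite gauss_cdf_ge0 gauss_cdf_le1.
apply: measurableT_comp.
  by apply: continuous_measurable_fun; exact: continuous_gauss_cdf.
by apply: measurable_funM => //; exact: measurable_funB.
Qed.

Lemma gauss_average_heaviside a b : 0 < b ->
  gauss_average a b heaviside =1 affine_gauss_cdf a b.
Proof.
move=> b0 y; apply: EFin_inj; rewrite shift_average_heaviside; last exact: measurable_idR.
by rewrite /= normal_prob_gauss.
Qed.

Lemma gauss_average_gauss a b a' b' : 0 < b -> 0 < b' ->
  gauss_average a b (affine_gauss_cdf a' b') =1
  affine_gauss_cdf (a + a') (Num.sqrt (b ^+ 2 + b' ^+ 2)).
Proof.
move=> b0 b'0 y; apply: EFin_inj.
rewrite shift_averageE; [|exact: measurable_idR|exact: affine_gauss_test].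
by rewrite gauss_conv// /affine_gauss_cdf opprD addrA.
Qed.

Lemma gauss_iter_comm d (T : measurableType d) (P : probability T R) (X : T -> R)
    (mX : measurable_fun setT X) a b n f : test_function f ->
  iter n (shift_average P X) (gauss_average a b f) =1
  gauss_average a b (iter n (shift_average P X) f).
Proof.
move=> tf; elim: n => // n IH y /=.
rewrite (shift_average_ext _ _ IH) shift_average_comm//; last exact: test_iter.
exact: measurable_idR.
Qed.
End GaussAverage.
End ShiftAverage.

(** * Approximately additive norming sequences *)

Section Geometric.
Context {R : realType}.

Lemma geometric_small (q x : R) : 1 < q -> exists i : nat, x <= q ^+ i.
Proof.
move=> q1; exists (Num.bound (`|x| / (q - 1))).
set n := Num.bound _; have q0 : 0 < q - 1 by lra.
have h : `|x| <= n%:R * (q - 1).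
  by rewrite -ler_pdivrMr// ltW// archi_boundP// divr_ge0// ltW.
have B (k : nat) : 1 + k%:R * (q - 1) <= q ^+ k.
  elim: k => [|k IH]; first by rewrite mul0r addr0 expr0.
  rewrite exprS -natr1; apply: (le_trans (y := q * (1 + k%:R * (q - 1)))).
    have : 0 <= k%:R * (q - 1) ^+ 2 by rewrite mulr_ge0// sqr_ge0.
    by rewrite expr2; lra.
  by rewrite ler_pM2l//; lra.
by have := B n; have := ler_norm x; lra.
Qed.

Lemma le0_of_le_geometric (C x : R) :
  (forall i : nat, x <= C * (3 / 4) ^+ i) -> x <= 0.
Proof.
move=> h; rewrite leNgt; apply/negP => x0.
have [|i hi] := @geometric_small (4 / 3) (C / x + 1); first by lra.
have C0 : 0 < C by have := h 0%N; rewrite expr0 mulr1; lra.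
have e : (3 / 4) ^+ i * (4 / 3) ^+ i = 1 :> R.
  by rewrite -exprMn (_ : 3 / 4 * (4 / 3) = 1) ?expr1n//; field.
have g0 : 0 < (3 / 4) ^+ i :> R by rewrite exprn_gt0//; lra.
have h2 : C + x <= x * (4 / 3) ^+ i.
  have -> : C + x = x * (C / x + 1) by field; rewrite gt_eqF.
  by rewrite ler_pM2l.
have h3 : (3 / 4) ^+ i * (C + x) <= x.
  apply: (le_trans (y := (3 / 4) ^+ i * (x * (4 / 3) ^+ i))).
    by rewrite ler_pM2l.
  by rewrite mulrCA e mulr1.
have := h i; have := mulr_gt0 g0 x0; lra.
Qed.

(** The intervals centred at u i with radius 3 C (3/4)^i are nested. *)
Lemma geometric_limit (u : nat -> R) (C : R) :
    (forall i, `|u i.+1 - u i| <= C * (3 / 4) ^+ i.+1) ->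
  exists l, forall i, `|u i - l| <= 3 * C * (3 / 4) ^+ i.
Proof.
move=> h; pose e (i : nat) : R := 3 * C * (3 / 4) ^+ i.
have C0 : 0 <= C by have := le_trans (normr_ge0 _) (h 0%N); rewrite expr1; lra.
have e0 i : 0 <= e i by rewrite mulr_ge0 ?exprn_ge0//; lra.
have up i k : u i - e i <= u (i + k)%N - e (i + k)%N.
  elim: k => [|k]; first by rewrite addn0.
  move/le_trans; apply; rewrite addnS; set j := (i + k)%N.
  by have := h j; rewrite ler_norml /e exprS => /andP[]; lra.
have dn i k : u (i + k)%N + e (i + k)%N <= u i + e i.
  elim: k => [|k]; first by rewrite addn0.
  apply: le_trans; rewrite addnS; set j := (i + k)%N.
  by have := h j; rewrite ler_norml /e exprS => /andP[]; lra.
have cross i j : u i - e i <= u j + e j.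
  apply: (le_trans (up i j)); apply: (le_trans _ (dn j i)).
  by rewrite addnC; have := e0 (j + i)%N; lra.
pose A := [set u i - e i | i in [set: nat]].
exists (sup A) => i; rewrite -/(e i) ler_distl; apply/andP; split.
  rewrite -lerBrDr opprK; apply: ge_sup; first by exists (u 0%N - e 0%N), 0%N.
  by move=> _ [j _ <-].
rewrite -lerBlDr; apply: sup_upper_bound; last by exists i.
split; first by exists (u 0%N - e 0%N), 0%N.
by exists (u 0%N + e 0%N) => _ [j _ <-].
Qed.
End Geometric.

Section ApproximatelyAdditive.
Context {R : realType}.
Variables a b : nat -> R.
Hypothesis b_gt0 : forall n, (1 <= n)%N -> 0 < b n.
Hypothesis approx_add : forall e : R, 0 < e -> exists M : nat, (1 <= M)%N /\
  forall m j, (M <= m)%N -> (M <= j)%N ->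
    `|a (m + j)%N - a m - a j| <= e * b (m + j)%N /\
    `|b m ^+ 2 + b j ^+ 2 - b (m + j)%N ^+ 2| <= e * b (m + j)%N ^+ 2.

Let v n := b n ^+ 2.
Let v_gt0 n : (1 <= n)%N -> 0 < v n.
Proof. by move=> n1; rewrite exprn_gt0// b_gt0. Qed.

Lemma approx_var (e : R) : 0 < e -> exists M : nat, (1 <= M)%N /\
  forall m j, (M <= m)%N -> (M <= j)%N ->
    v m + v j <= (1 + e) * v (m + j)%N /\ (1 - e) * v (m + j)%N <= v m + v j.
Proof.
move=> /approx_add[M [M1 h]]; exists M; split=> // m j hm hj.
by have [_] := h m j hm hj; rewrite ler_norml => /andP[]; rewrite -!/(v _); lra.
Qed.

(** Cut p into two halves i times, down to pieces of size at least 2 j: as v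
    (m + j) >= 2/3 (v m + v j), each cut gains a factor 4/3. *)
Lemma var_dominates : exists M : nat, (1 <= M)%N /\ forall e : R, 0 < e ->
  exists K : nat, forall j p, (M <= j)%N -> (K * j <= p)%N -> v j <= e * v p.
Proof.
have [|M [M1 hM]] := @approx_var (2^-1); first by lra.
exists M; split=> // e e0.
have main i : forall j p, (M <= j)%N -> (2 ^ i.+1 * j <= p)%N ->
    2 / 3 * (4 / 3) ^+ i * v j <= v p.
  elim: i => [|i IH] j p Mj jp.
    have [] := hM j (p - j)%N Mj ltac:(lia); rewrite subnKC; last by lia.
    have := @v_gt0 (p - j)%N ltac:(lia); rewrite expr0; lra.
  rewrite expnS in jp.
  have h1 := IH j (p./2) Mj ltac:(lia).
  have h2 := IH j (p - p./2)%N Mj ltac:(lia).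
  have M2 : (j <= 2 ^ i.+1 * j)%N by rewrite leq_pmull// expn_gt0.
  have [] := hM (p./2) (p - p./2)%N ltac:(lia) ltac:(lia).
  rewrite subnKC; last by lia.
  rewrite exprS; lra.
have [|i hi] := @geometric_small R (4 / 3) (3 / 2 / e); first by lra.
exists (2 ^ i.+1)%N => j p Mj jp; have h := main i j p Mj jp.
have v0 := @v_gt0 j ltac:(lia).
rewrite -(ler_pM2l (x := e^-1)) ?invr_gt0// mulKf ?gt_eqF//; apply: le_trans h.
by rewrite ler_pM2r//; lra.
Qed.

(** Compare both v (m + i) and v m with v (m - M): they differ from it by v (i
    + M) and v M, which are negligible by [var_dominates]. Removing a fixed M
    first makes both increments large enough for approximate additivity. *)
Lemma var_slowly_varying (e : R) : 0 < e -> exists K M : nat, (1 <= M)%N /\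
  forall m i, (M <= m)%N -> (K * i <= m)%N -> `|v (m + i)%N - v m| <= e * v m.
Proof.
move=> e0; have [t [t0 te t8]] : exists t : R, [/\ 0 < t, 8 * t <= e & t <= 8^-1].
  exists (Num.min (e / 8) (8^-1)); rewrite lt_min !ge_min lexx orbT.
  split=> //; first by apply/andP; split; lra.
  by case: (leP (e / 8) 8^-1) => ?; lra.
have [M1 [M11 hM1]] := approx_var t0.
have [M2 [M21 hM2]] := var_dominates.
have [K hK] := hM2 t t0.
pose M := maxn M1 M2; exists (2 * K)%N, (3 * M + 2 * (K * M))%N.
split; first by lia.
move=> m i Mm; rewrite -mulnA => Kim; pose p := (m - M)%N.
have [Mp iM MM p1 m1] : [/\ M1 <= p, M1 <= i + M, M1 <= M, 1 <= p & 1 <= m]%N.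
  by split; lia.
have [M2i M2M Kp Kp' M'1] : [/\ M2 <= i + M, M2 <= M, K * (i + M) <= p, K * M <= p & 1 <= M]%N.
  by rewrite mulnDr; split; lia.
have [e1 e2] : (p + (i + M) = m + i /\ p + M = m)%N by lia.
have [mi1 i1] : (1 <= m + i /\ 1 <= i + M)%N by lia.
have [h1 h2] := hM1 p (i + M)%N Mp iM.
have [h3 h4] := hM1 p M Mp MM.
rewrite e1 in h1 h2; rewrite e2 in h3 h4.
have d1 := hK (i + M)%N p M2i Kp.
have d2 := hK M p M2M Kp'.
have p0 := v_gt0 p1; have m0 := v_gt0 m1; have mi0 := v_gt0 mi1.
have i0 := v_gt0 i1; have M0 := v_gt0 M'1.
set x := v (m + i)%N in h1 h2 mi0 *; set y := v m in h3 h4 m0 *.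
have A (r s : R) : 0 < r -> 0 < s -> v p <= (1 + t) * s -> (1 - t) * r <= (1 + t) * v p ->
    r <= (1 + e) * s.
  move=> r0 s0 H1 H2.
  have : (1 - t) * r <= (1 + t) * ((1 + t) * s).
    by apply: le_trans H2 _; rewrite ler_pM2l//; lra.
  have : (1 + t) * (1 + t) * s <= (1 - t) * (1 + 8 * t) * s.
    by rewrite ler_pM2r//; nra.
  move=> H3 H4; have : (1 - t) * r <= (1 - t) * ((1 + 8 * t) * s) by lra.
  rewrite ler_pM2l; last by lra.
  by move/le_trans; apply; rewrite ler_pM2r//; lra.
have B1 : x <= (1 + e) * y by apply: A => //; lra.
have B2 : y <= (1 + e) * x by apply: A => //; lra.
rewrite ler_norml; apply/andP; split; last by lra.
rewrite lerBrDl.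
have [le1|le1] := leP 1 e; first by nra.
have : (1 - e) * y <= (1 - e) * ((1 + e) * x) by rewrite ler_pM2l//; lra.
nra.
Qed.

Lemma scale_ratio (e : R) : 0 < e -> exists K M : nat, (1 <= M)%N /\
  forall m k, (M <= m)%N -> (K * (k - m) <= m)%N -> (K * (m - k) <= m)%N ->
    `|b k / b m - 1| <= e.
Proof.
move=> e0; have [t [t0 te t2]] : exists t : R, [/\ 0 < t, 2 * t <= e & t <= 2^-1].
  exists (Num.min (e / 2) (2^-1)); rewrite lt_min !ge_min lexx orbT.
  split=> //; first by apply/andP; split; lra.
  by case: (leP (e / 2) 2^-1) => ?; lra.
have [K [M [M1 h]]] := var_slowly_varying t0.
exists (2 * K + 2)%N, (2 * M)%N; split; first by lia.
move=> m k Mm h1 h2.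
have bm := @b_gt0 m ltac:(lia).
have bk := @b_gt0 k ltac:(lia).
have key : `|v k - v m| <= 2 * t * v m.
  have [mk|km] := leqP m k.
    have := h m (k - m)%N ltac:(lia) ltac:(lia); rewrite subnKC// => /le_trans; apply.
    by rewrite ler_pM2r ?v_gt0//; lia || lra.
  have := h k (m - k)%N ltac:(lia) ltac:(lia); rewrite subnKC; last by lia.
  have v1 := @v_gt0 k ltac:(lia); have v2 := @v_gt0 m ltac:(lia).
  rewrite distrC !ler_norml => /andP[H1 H2]; apply/andP; split; nra.
set r := b k / b m.
have r0 : 0 < r by rewrite divr_gt0.
have : `|r ^+ 2 - 1| <= 2 * t.
  have -> : r ^+ 2 - 1 = (v k - v m) / v m.
    by rewrite /r /v; field; rewrite gt_eqF.
  have vm : 0 < v m by rewrite exprn_gt0.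
  by rewrite normrM normfV (gtr0_norm vm) ler_pdivrMr.
rewrite !ler_norml => /andP[H1 H2]; apply/andP; split; nra.
Qed.

(** Splitting m into halves nearly doubles v = b^2, so v grows faster than
    every power of m with exponent below 1; the exponent 3/4 exceeds the 2/3
    that the Lindeberg error requires. The constant c is a minimum over one
    dyadic block. *)
Lemma scale_growth : exists (c : R) (M : nat), [/\ 0 < c, (1 <= M)%N &
  forall m, (M <= m)%N -> c * m%:R ^+ 3 <= b m ^+ 8].
Proof.
have [|M0 [M01 hM]] := @approx_var (20^-1); first by lra.
pose M := maxn M0 4.
have v4 n : b n ^+ 8 = v n ^+ 4 by rewrite /v -exprM.
have [c [c0 hc]] : exists c : R, 0 < c /\
    forall m, (M <= m < 2 * M)%N -> c * m%:R ^+ 3 <= v m ^+ 4.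
  elim: (2 * M)%N => [|N [c [c0 IH]]]; first by exists 1; split => // m; lia.
  have [MN|NM] := leqP M N; last by exists c; split => // m; lia.
  have N0 : 0 < N%:R ^+ 3 :> R by rewrite exprn_gt0// ltr0n; lia.
  have w0 : 0 < v N ^+ 4 by rewrite exprn_gt0// v_gt0; lia.
  exists (Num.min c (v N ^+ 4 / N%:R ^+ 3)); split.
    by rewrite lt_min c0 divr_gt0.
  move=> m /andP[Mm]; rewrite ltnS leq_eqVlt => /predU1P[->|mN].
    by rewrite -ler_pdivlMr// ge_min lexx orbT.
  apply: le_trans (IH m _); last by rewrite Mm.
  by rewrite ler_wpM2r ?exprn_ge0// ge_min lexx.
exists c, M; split=> //; first by lia.
move=> m; rewrite v4; have [n] := ubnP m; elim: n m => // n IH m mn Mm.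
have [m2|m2] := ltnP m (2 * M); first by apply: hc; rewrite Mm.
pose p := m./2; pose q := (m - p)%N.
have [pq' pm' qm' Mp Mq] : [/\ 4 * m <= 9 * p, p < n, q < n, M <= p & M <= q]%N.
  by split; lia.
have [M0p M0q p1 q1 m1] : [/\ M0 <= p, M0 <= q, 1 <= p, 1 <= q & 1 <= m]%N.
  by split; lia.
have [epq lpq] : ((p + q = m) /\ (p <= q))%N by lia.
have h1 := IH p pm' Mp; have h2 := IH q qm' Mq.
have [h3 _] := hM p q M0p M0q; rewrite epq in h3.
have p0 := v_gt0 p1; have q0 := v_gt0 q1; have m0 := v_gt0 m1.
have [w [w0 wp wq wc]] : exists w : R, [/\ 0 <= w, w <= v p, w <= v q & c * p%:R ^+ 3 <= w ^+ 4].
  have pq : c * p%:R ^+ 3 <= v q ^+ 4.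
    by apply: le_trans h2; rewrite ler_pM2l// lerXn2r ?nnegrE// ler_nat.
  have [vpq|vqp] := leP (v p) (v q).
    by exists (v p); split=> //; apply: ltW.
  by exists (v q); split=> //; apply: ltW.
have h4 : 2 * w <= (1 + 20^-1) * v m by lra.
have h5 : (2 * w) ^+ 4 <= ((1 + 20^-1) * v m) ^+ 4.
  by rewrite lerXn2r ?nnegrE// mulr_ge0//; lra.
have mp : m%:R <= 9 / 4 * p%:R :> R.
  have : (4 * m)%:R <= (9 * p)%:R :> R by rewrite ler_nat.
  by rewrite !natrM; lra.
have mp3 : m%:R ^+ 3 <= (9 / 4 * p%:R) ^+ 3 :> R.
  by rewrite lerXn2r ?nnegrE// mulr_ge0//; lra.
have : c * m%:R ^+ 3 <= c * (9 / 4 * p%:R) ^+ 3 by rewrite ler_pM2l.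
move: h5; rewrite !exprMn.
have : 0 <= w ^+ 4 by rewrite exprn_ge0.
have : 0 <= v m ^+ 4 by rewrite exprn_ge0// ltW.
lra.
Qed.

(** The Hyers-Ulam argument: a (2^i m) / 2^i converges because b (2^i m) / 2^i
    tends to 0 geometrically, its limit f m is exactly additive for large m,
    hence linear, and a m differs from f m by o(b m). *)
Lemma center_linear : exists mu : R, forall e : R, 0 < e -> exists M : nat,
  (1 <= M)%N /\ forall m, (M <= m)%N -> `|a m - m%:R * mu| <= e * b m.
Proof.
have [|M0 [M01 hM0]] := @approx_var (9^-1); first by lra.
have dbl m : (M0 <= m)%N -> b (2 * m)%N <= 3 / 2 * b m.
  move=> Mm; have [_] := hM0 m m Mm Mm; rewrite addnn -mul2n => h.
  have b1 := @b_gt0 m ltac:(lia); have b2 := @b_gt0 (2 * m)%N ltac:(lia).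
  by rewrite -ler_sqr ?nnegrE; [rewrite exprMn -!/(v _); lra|lra|lra].
have pow i m : (M0 <= m)%N -> b (2 ^ i * m)%N <= (3 / 2) ^+ i * b m.
  move=> Mm; elim: i => [|i IH]; first by rewrite mul1n mul1r.
  have le1 : (m <= 2 ^ i * m)%N by rewrite leq_pmull// expn_gt0.
  rewrite expnS -mulnA exprS; apply: le_trans (dbl _ _) _; first by lia.
  lra.
have half i : (3 / 2) ^+ i / 2 ^+ i = (3 / 4) ^+ i :> R.
  by rewrite -expr_div_n; congr (_ ^+ _); field.
have pow2 i m : (M0 <= m)%N -> b (2 ^ i * m)%N / 2 ^+ i <= (3 / 4) ^+ i * b m.
  move=> Mm; rewrite ler_pdivrMr ?exprn_gt0// (le_trans (pow i m Mm))//.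
  by rewrite -half mulrAC divfK// expf_neq0.
pose A m (i : nat) : R := a (2 ^ i * m)%N / 2 ^+ i.
have stepA e M : 0 < e -> (M0 <= M)%N -> (forall m j, (M <= m)%N -> (M <= j)%N ->
    `|a (m + j)%N - a m - a j| <= e * b (m + j)%N) ->
    forall m i, (M <= m)%N -> `|A m i.+1 - A m i| <= e * b m * (3 / 4) ^+ i.+1.
  move=> e0 M0M h m i Mm; have le1 : (m <= 2 ^ i * m)%N by rewrite leq_pmull// expn_gt0.
  have := h (2 ^ i * m)%N (2 ^ i * m)%N ltac:(lia) ltac:(lia).
  rewrite addnn -mul2n mulnA -expnS => h1.
  have -> : A m i.+1 - A m i =
     (a (2 ^ i.+1 * m)%N - a (2 ^ i * m)%N - a (2 ^ i * m)%N) / 2 ^+ i.+1.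
    by rewrite /A exprS; field; rewrite expf_neq0.
  rewrite normrM (ger0_norm (x := (2 ^+ i.+1)^-1)) ?invr_ge0 ?exprn_ge0//.
  apply: (le_trans (y := e * b (2 ^ i.+1 * m)%N / 2 ^+ i.+1)).
    by rewrite ler_pM2r ?invr_gt0 ?exprn_gt0.
  rewrite -!mulrA ler_pM2l// [leRHS]mulrC; exact/pow2/(leq_trans M0M Mm).
(* The error bound with constant 1 suffices to define the limit f; the sharp
   bound is only used at the end, for the distance from a m to f m. *)
have [M1 [M11 hM1]] := approx_add ltr01.
pose M := maxn M0 M1.
have MM m : (M <= m)%N -> (M0 <= m)%N /\ (M1 <= m)%N by lia.
have st1 := @stepA 1 M ltr01 ltac:(lia)
  (fun m j hm hj => (hM1 m j (MM _ hm).2 (MM _ hj).2).1).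
have fP m : exists l, (M <= m)%N -> forall i, `|A m i - l| <= 3 * b m * (3 / 4) ^+ i.
  have [Mm|_] := leqP M m; last by exists 0.
  have [l hl] := geometric_limit (fun i => st1 m i Mm).
  by exists l => _ i; rewrite (le_trans (hl i))// mul1r.
have [f hf] := choice fP.
have fadd m j : (M <= m)%N -> (M <= j)%N -> f (m + j)%N = f m + f j.
  move=> Mm Mj; apply/eqP; rewrite -subr_eq0 -normr_le0.
  apply: (@le0_of_le_geometric _ (4 * b (m + j)%N + 3 * b m + 3 * b j)) => i.
  have H1 := hf (m + j)%N ltac:(lia) i; have H2 := hf m Mm i; have H3 := hf j Mj i.
  have H4 : `|A (m + j)%N i - A m i - A j i| <= b (m + j)%N * (3 / 4) ^+ i.
    have le1 : (m <= 2 ^ i * m)%N by rewrite leq_pmull// expn_gt0.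
    have le2 : (j <= 2 ^ i * j)%N by rewrite leq_pmull// expn_gt0.
    have [] := hM1 (2 ^ i * m)%N (2 ^ i * j)%N ltac:(lia) ltac:(lia).
    rewrite -mulnDr mul1r => H _.
    rewrite /A -!mulrBl normrM (ger0_norm (x := (2 ^+ i)^-1)) ?invr_ge0 ?exprn_ge0//.
    apply: (le_trans (y := b (2 ^ i * (m + j))%N / 2 ^+ i)).
      by rewrite ler_pM2r ?invr_gt0 ?exprn_gt0.
    by rewrite mulrC [leRHS]mulrC mulrC; apply: pow2; lia.
  move: H1 H2 H3 H4; rewrite !ler_norml.
  move=> /andP[? ?] /andP[? ?] /andP[? ?] /andP[? ?]; apply/andP; split; lra.
pose mu := f M.+1 - f M.
have f_lin i : f (M + i)%N = f M + i%:R * mu.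
  elim: i => [|i IH]; first by rewrite addn0 mul0r addr0.
  have e1 := fadd (M + i)%N M.+1 ltac:(lia) ltac:(lia).
  have e2 := fadd (M + i.+1)%N M ltac:(lia) ltac:(lia).
  rewrite (_ : M + i.+1 + M = M + i + M.+1)%N in e2; last by lia.
  rewrite -natr1 mulrDl mul1r addrA -IH /mu; lra.
have fM : f M = M%:R * mu by have := fadd M M (leqnn _) (leqnn _); have := f_lin M; lra.
exists mu => e e0.
have [|M2 [M21 hM2]] := @approx_add (e / 3); first by lra.
exists (maxn M M2); split; first by lia.
move=> m Mm.
have -> : m%:R * mu = f m.
  by rewrite -[in RHS](@subnKC M m) ?f_lin ?fM ?natrB; [ring|lia|lia].
have Ai i : `|A m i - a m| <= e * b m * (1 - (3 / 4) ^+ i).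
  have st2 := @stepA (e / 3) (maxn M M2) ltac:(lra) ltac:(lia)
    (fun m j hm hj => (hM2 m j ltac:(lia) ltac:(lia)).1).
  elim: i => [|i IH].
    by rewrite /A expn0 mul1n expr0 divr1 subrr normr0 subrr mulr0.
  have := st2 m i ltac:(lia); move: IH; rewrite !ler_norml exprS.
  move=> /andP[? ?] /andP[? ?]; apply/andP; split; lra.
rewrite -subr_le0; apply: (@le0_of_le_geometric _ (3 * b m)) => i.
have := Ai i; have := hf m ltac:(lia) i.
have : 0 <= e * b m * (3 / 4) ^+ i.
  by rewrite !mulr_ge0 ?exprn_ge0 ?ltW// ?b_gt0//; lia || lra.
move=> H0 /ler_normlP[H1 H2] /ler_normlP[H3 H4].
by rewrite lerBlDr ler_norml; apply/andP; split; lra.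
Qed.
End ApproximatelyAdditive.

(** * The number of records *)

Section Records.
Context {R : realType}.
Implicit Types (g h : nat -> R) (m k : nat).

(** The probability that observation number m + 2 is a record. *)
Definition inv_rank m : R := m.+2%:R^-1.

(** [record_mean m g] is the expectation of g D, with D the sum of independent
    Bernoulli variables of parameters [inv_rank i], i < m. The recursion
    conditions on the last of them. *)
Fixpoint record_mean m g : R :=
  if m is m'.+1 then
    record_mean m' (fun k => (1 - inv_rank m') * g k + inv_rank m' * g k.+1)
  else g 0%N.

Definition record_expect m : R := \sum_(i < m) inv_rank i.
Definition record_var m : R := \sum_(i < m) inv_rank i * (1 - inv_rank i).

Lemma inv_rank_itv m : 0 < inv_rank m <= 2^-1.
Proof. by rewrite invr_gt0 ltr0n /= lef_pV2 ?posrE ?ltr0n// ler_nat. Qed.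

Lemma eq_record_mean m g h : g =1 h -> record_mean m g = record_mean m h.
Proof. by move=> gh; elim: m g h gh => //= m IH g h gh; apply: IH => k; rewrite !gh. Qed.

Lemma le_record_mean m g h : (forall k, g k <= h k) -> record_mean m g <= record_mean m h.
Proof.
elim: m g h => //= m IH g h gh; apply: IH => k.
by have /andP[p0 p1] := inv_rank_itv m; rewrite lerD// ler_wpM2l//; lra.
Qed.

Lemma record_mean_lin m g h (r s : R) :
  record_mean m (fun k => r * g k + s * h k) = r * record_mean m g + s * record_mean m h.
Proof.
elim: m g h => //= m IH g h; rewrite -IH; apply: eq_record_mean => k; ring.
Qed.

Lemma record_mean_cst m (r : R) : record_mean m (fun=> r) = r.
Proof.
elim: m => //= m IH; rewrite -[RHS]IH; apply: eq_record_mean => k; ring.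
Qed.

Lemma record_mean_dist m g h e :
  (forall k, `|g k - h k| <= e k) -> `|record_mean m g - record_mean m h| <= record_mean m e.
Proof.
move=> ghe.
have E1 : record_mean m g - record_mean m h = record_mean m (fun k => 1 * g k + (-1) * h k).
  by rewrite record_mean_lin; ring.
rewrite E1 ler_norml; apply/andP; split.
  have -> : - record_mean m e = record_mean m (fun k => (-1) * e k + 0 * e k).
    by rewrite record_mean_lin; ring.
  apply: le_record_mean => k; have := ghe k; rewrite ler_norml => /andP[]; lra.
apply: le_record_mean => k; have := ghe k; rewrite ler_norml => /andP[]; lra.
Qed.

(** The mean square distance of D to x is its variance plus the squared
    bias. *)
Lemma record_mean_sqr m (x : R) :
  record_mean m (fun k => (k%:R - x) ^+ 2) = record_var m + (record_expect m - x) ^+ 2.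
Proof.
elim: m x => [|m IH] x /=.
  by rewrite /record_var /record_expect !big_ord0; ring.
rewrite /record_var /record_expect !big_ord_recr /= -!/(record_var _) -!/(record_expect _).
set p := inv_rank m.
rewrite (@eq_record_mean _ _ (fun k => 1 * (k%:R - (x - p)) ^+ 2 + (p * (1 - p)) * 1)); last first.
  by move=> k; rewrite -natr1; ring.
by rewrite record_mean_lin IH record_mean_cst; ring.
Qed.

Lemma record_var_ge0 m : 0 <= record_var m.
Proof. by apply: sumr_ge0 => i _; have /andP[] := inv_rank_itv i; nra. Qed.

Lemma record_var_le m : record_var m <= record_expect m.
Proof.
apply: ler_sum => i _; have /andP[p0 p1] := inv_rank_itv i.
by rewrite ler_piMr ?ltW//; lra.
Qed.

Lemma record_expect_ge0 m : 0 <= record_expect m.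
Proof. exact: le_trans (record_var_ge0 m) (record_var_le m). Qed.

Lemma record_expect_le m n : (m <= n)%N -> record_expect m <= record_expect n.
Proof.
move=> /subnKC <-; elim: (n - m)%N => [|k IH]; first by rewrite addn0.
apply: le_trans IH _; rewrite addnS /record_expect big_ord_recr /= lerDl.
by rewrite ltW//; case/andP: (inv_rank_itv (m + k)).
Qed.

(** The m + 2 terms that follow the first m ones are each at least 1 / (2 (m +
    2)), so they contribute at least one half. *)
Lemma record_expect_infty (A : R) : exists M, forall m, (M <= m)%N -> A <= record_expect m.
Proof.
have dbl m : record_expect m + 2^-1 <= record_expect (m + m.+2)%N.
  rewrite /record_expect big_split_ord /= lerD2l.
  apply: (le_trans (y := \sum_(i < m.+2) (2 * m.+2%:R)^-1)).
    by rewrite sumr_const card_ord -[leRHS]mulr_natl invfM mulrCA divff ?mulr1// pnatr_eq0.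
  apply: ler_sum => i _; rewrite /inv_rank lef_pV2 ?posrE ?mulr_gt0 ?ltr0n//.
  rewrite -natrM ler_nat mul2n -addnn; case: i => i /= hi.
  by rewrite -[leqLHS]addn2 addnAC addn2 leq_add2l ltnW.
suff [M hM] : exists M, A <= record_expect M.
  by exists M => m /record_expect_le; exact: le_trans.
have [n An] : exists n : nat, A <= n%:R / 2.
  exists (Num.bound (`|A| * 2)); rewrite ler_pdivlMr// ltW//.
  apply: le_lt_trans (archi_boundP (mulr_ge0 (normr_ge0 A) _)) => //.
  by rewrite ler_pM2r// ler_norm.
suff [M hM] : exists M, n%:R / 2 <= record_expect M by exists M; exact: le_trans hM.
elim: n {An} => [|n [M IH]]; first by exists 0%N; rewrite mul0r record_expect_ge0.
by exists (M + M.+2)%N; apply: le_trans (dbl M); rewrite -natr1; lra.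
Qed.

(** Lindeberg's replacement: conditioning on all Bernoulli variables but the
    last, [bernoulli_gauss_step] exchanges the last one for variance,
    enlarging b, and the induction hypothesis applies with the enlarged b, for
    which its error bound is smaller. *)
Lemma record_lindeberg m (mu b y : R) : 0 < b -> `|mu| <= b ->
  `|record_mean m (fun k => gauss_cdf ((y - mu * k%:R) / b)) -
    gauss_cdf ((y - mu * record_expect m) / Num.sqrt (b ^+ 2 + mu ^+ 2 * record_var m))|
  <= 27 * record_expect m * (`|mu| / b) ^+ 3.
Proof.
elim: m b y => [|m IH] b y b0 mub.
  rewrite /= /record_var /record_expect !big_ord0 !mulr0 addr0 sqrtr_sqr (gtr0_norm b0).
  by rewrite mul0r subrr normr0.
rewrite /=; set p := inv_rank m; have /andP[p0 p1] := inv_rank_itv m.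
have q0 : 0 <= p * (1 - p) by rewrite -/p in p0 p1; nra.
pose s := Num.sqrt (b ^+ 2 + mu ^+ 2 * (p * (1 - p))).
have s2 : s ^+ 2 = b ^+ 2 + mu ^+ 2 * (p * (1 - p)).
  by rewrite sqr_sqrtr// addr_ge0 ?sqr_ge0// mulr_ge0// sqr_ge0.
have b20 : 0 < b ^+ 2 by rewrite exprn_gt0.
have m20 : 0 <= mu ^+ 2 * (p * (1 - p)) by rewrite mulr_ge0// sqr_ge0.
have s0 : 0 < s by rewrite sqrtr_gt0; lra.
have bs : b <= s by rewrite -ler_sqr ?nnegrE; [rewrite s2; lra|lra|lra].
have := IH s (y - mu * p) s0 (le_trans mub bs).
rewrite s2 {2 3}/record_expect {2}/record_var !big_ord_recr /= -/(record_var _) -/(record_expect _).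
rewrite -/p (_ : y - mu * p - mu * record_expect m = y - mu * (record_expect m + p)); last by ring.
rewrite (_ : b ^+ 2 + mu ^+ 2 * (p * (1 - p)) + mu ^+ 2 * record_var m =
  b ^+ 2 + mu ^+ 2 * (record_var m + p * (1 - p))); last by ring.
set G := gauss_cdf _; set E1 := record_mean m _ => H1.
set E2 := record_mean m _.
have step : `|E2 - E1| <= 27 * p * (`|mu| / b) ^+ 3.
  rewrite -[leRHS](record_mean_cst m); apply: record_mean_dist => k.
  pose x := (y - mu * p - mu * k%:R) / b.
  have -> : (y - mu * k%:R) / b = x + p * (mu / b) by rewrite /x; field; rewrite gt_eqF.
  have -> : (y - mu * k.+1%:R) / b = x - (1 - p) * (mu / b).
    by rewrite /x -natr1; field; rewrite gt_eqF.
  have -> : (y - mu * p - mu * k%:R) / s = b / s * x.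
    by rewrite /x; field; rewrite !gt_eqF.
  have nd : `|mu / b| = `|mu| / b by rewrite normrM normfV (gtr0_norm b0).
  rewrite -nd; apply: bernoulli_gauss_step; first by rewrite ltW.
  - by rewrite /p; lra.
  - by rewrite nd ler_pdivrMr// mul1r.
  - by rewrite divr_gt0.
  - rewrite !expr_div_n s2; field.
    by rewrite (gt_eqF b0) -s2 (gt_eqF (exprn_gt0 2 s0)).
have mb : (`|mu| / s) ^+ 3 <= (`|mu| / b) ^+ 3.
  have [b0' s0'] : 0 <= b /\ 0 <= s by rewrite !ltW.
  rewrite lerXn2r ?nnegrE ?divr_ge0//.
  by rewrite ler_wpM2l// lef_pV2.
have : 27 * record_expect m * (`|mu| / s) ^+ 3 <= 27 * record_expect m * (`|mu| / b) ^+ 3.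
  by rewrite ler_wpM2l// mulr_ge0// record_expect_ge0.
move=> H3; rewrite (_ : E2 - G = (E2 - E1) + (E1 - G)); last by ring.
apply: le_trans (ler_normD _ _) _.
rewrite [record_expect m.+1]big_ord_recr /= -/(record_expect m) -/p.
move: H1 step H3; lra.
Qed.
End Records.

(** * From the central limit theorem to its norming sequences *)

Section Polya.
Context {R : realType}.
Local Notation Phi := (@gauss_cdf R).

Lemma gauss_cdf_tails (e : R) : 0 < e -> exists A : R, Phi (- A) <= e /\ 1 - e <= Phi A.
Proof.
move=> e0.
have /cvgrPdist_le/(_ e e0)[A1 [_ h1]] := @gauss_cdf_cvgy R.
have /cvgrPdist_le/(_ e e0)[A2 [_ h2]] := @gauss_cdf_cvgNy R.
exists (`|A1| + `|A2| + 1); split.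
  have h : - (`|A1| + `|A2| + 1) < A2.
    by have := ler_norm (- A2); rewrite normrN; have := normr_ge0 A1; lra.
  by have := h2 _ h; rewrite sub0r normrN ger0_norm ?gauss_cdf_ge0.
have h : A1 < `|A1| + `|A2| + 1.
  by have := ler_norm A1; have := normr_ge0 A2; lra.
by have /ler_normlP[] := h1 _ h; lra.
Qed.

(** Polya's theorem: the functions are monotone and the limit is Lipschitz, so
    closeness on a finite grid of mesh e / 18, outside which Phi is within e /
    2 of 0 or 1, is enough. *)
Lemma gauss_cdf_uniform_cvg (H : nat -> R -> R) :
    (forall n x, 0 <= H n x <= 1) ->
    (forall n x y, x <= y -> H n x <= H n y) ->
    (forall x, H n x @[n --> \oo] --> Phi x) ->
  forall e : R, 0 < e -> exists M : nat, forall n, (M <= n)%N -> forall x, `|H n x - Phi x| <= e.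
Proof.
move=> H01 Hmono Hcvg e e0.
have [|A [A1 A2]] := @gauss_cdf_tails (e / 2); first by lra.
pose x_ (i : nat) : R := - A + i%:R * (e / 18).
have [N HN] : exists N : nat, A <= x_ N.
  exists (Num.bound (`|A| * (36 / e))); rewrite /x_.
  have : `|A| * (36 / e) < (Num.bound (`|A| * (36 / e)))%:R.
    by apply: archi_boundP; rewrite mulr_ge0// divr_ge0// ltW.
  rewrite -(ltr_pM2r (x := e / 18)); last by lra.
  have -> : `|A| * (36 / e) * (e / 18) = 2 * `|A| by field; rewrite gt_eqF.
  by have := ler_norm A; lra.
have [M hM] : exists M : nat, forall n, (M <= n)%N -> forall i, (i <= N)%N ->
    `|H n (x_ i) - Phi (x_ i)| <= e / 2.
  elim: N {HN} => [|N [M IH]].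
    have /cvgrPdist_le/(_ (e / 2)) := Hcvg (x_ 0%N).
    case; first by lra.
    move=> M _ hM; exists M => n Mn i; rewrite leqn0 => /eqP ->.
    by rewrite distrC; exact: hM.
  have /cvgrPdist_le/(_ (e / 2)) := Hcvg (x_ N.+1).
  case; first by lra.
  move=> M' _ hM; exists (maxn M M') => n; rewrite geq_max => /andP[Mn M'n] i.
  rewrite leq_eqVlt => /predU1P[->|]; first by rewrite distrC; exact: hM.
  by rewrite ltnS; exact: IH.
exists M => n Mn x; have {}hM := hM n Mn.
have main i : (i <= N)%N -> x <= x_ i -> `|H n x - Phi x| <= e.
  elim: i => [|i IH] iN xi.
    have := hM 0%N isT; have := Hmono n _ _ xi; have := gauss_cdf_le xi.
    have := gauss_cdf_ge0 x; have /andP[] := H01 n x.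
    move: A1; rewrite (_ : - A = x_ 0%N); last by rewrite /x_ mul0r addr0.
    by move=> ? ? ? ? ? ? /ler_normlP[? ?]; rewrite ler_norml; apply/andP; split; lra.
  have [/(IH (ltnW iN))//|/ltW ix] := leP x (x_ i).
  have := hM i (ltnW iN); have := hM i.+1 iN.
  have := gauss_cdf_le xi; have := gauss_cdf_le ix.
  have := Hmono n _ _ xi; have := Hmono n _ _ ix.
  have := gauss_cdf_lipschitz (x_ i) (x_ i.+1).
  have -> : `|x_ i.+1 - x_ i| = e / 18.
    by rewrite /x_ -natr1 (_ : _ - _ = e / 18) ?ger0_norm; [lra|lra|ring].
  move=> /ler_normlP[? ?] ? ? ? ? /ler_normlP[? ?] /ler_normlP[? ?].
  by rewrite ler_norml; apply/andP; split; lra.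
have [/(main N (leqnn _))//|/ltW Nx] := leP x (x_ N).
have := hM N (leqnn _); have := Hmono n _ _ Nx; have := gauss_cdf_le Nx.
have := gauss_cdf_le1 x; have /andP[] := H01 n x; have := gauss_cdf_le HN.
move=> ? ? ? ? ? ? /ler_normlP[? ?]; rewrite ler_norml; apply/andP; split; lra.
Qed.

(** Convergence of types, made quantitative: evaluate at z = 0 to locate c and
    at z = 1 to locate c + r, using that Phi is strictly increasing there. *)
Lemma gauss_types (e : R) : 0 < e -> exists2 t : R, 0 < t &
  forall c r : R, (forall z, `|Phi z - Phi (c + r * z)| <= t) -> `|c| <= e /\ `|r - 1| <= e.
Proof.
move=> e0; pose f := e / 2.
have f0 : 0 < f by rewrite /f; lra.
pose u (x y : R) : R := (Phi y - Phi x) / 2.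
have u0 x y : x < y -> 0 < u x y by move=> /(@gauss_cdf_lt R); rewrite /u; lra.
have low (p q : R) : 0 < p -> 0 < q -> exists t : R, [/\ 0 < t, t <= p & t <= q].
  by move=> p0 q0; case: (leP p q) => [pq|/ltW qp]; [exists p|exists q].
have [t [t0 t1 t2 t3 t4]] : exists t : R, [/\ 0 < t, t <= u 0 f, t <= u (- f) 0,
    t <= u 1 (1 + f) & t <= u (1 - f) 1].
  have [|//|t1 [t10 h1 h2]] := low (u 0 f) (u (- f) 0).
  - exact: u0.
  - by apply: u0; rewrite oppr_lt0.
  have [||t2 [t20 h3 h4]] := low (u 1 (1 + f)) (u (1 - f) 1).
  - by apply: u0; rewrite ltrDl.
  - by apply: u0; rewrite gtrDl oppr_lt0.
  have [//|//|t [t0 k1 k2]] := low t1 t2.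
  exists t; split; [exact: t0|exact: (le_trans k1 h1)|exact: (le_trans k1 h2)| |].
    exact: (le_trans k2 h3).
  exact: (le_trans k2 h4).
exists t => // c r h.
have key x y : `|Phi x - Phi y| <= t -> t <= u x (x + f) -> t <= u (x - f) x -> `|y - x| <= f.
  move=> /ler_normlP[h1 h2] h3 h4; rewrite ler_distl leNgt [X in _ && X]leNgt.
  have u1 : 0 < u (x - f) x by apply: u0; rewrite ltrBlDr ltrDl.
  have u2 : 0 < u x (x + f) by apply: u0; rewrite ltrDl.
  apply/andP; split; apply/negP => /(@gauss_cdf_lt R).
    by move: u1 h4; rewrite /u; move: {u2 h3 u0}h1; lra.
  by move: u2 h3; rewrite /u; move: {u1 h4 u0}h2; lra.
have /ler_normlP[c1 c2] : `|c - 0| <= f.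
  by apply: key; rewrite ?add0r ?sub0r//; have := h 0; rewrite mulr0 addr0.
have /ler_normlP[r1 r2] : `|c + r - 1| <= f.
  by apply: key => //; have := h 1; rewrite mulr1.
rewrite /f in c1 c2 r1 r2.
by split; rewrite ler_norml; apply/andP; split; lra.
Qed.
End Polya.

Section SumCdf.
Context {R : realType} d (T : measurableType d) (P : probability T R) (X : T -> R).
Hypothesis mX : measurable_fun setT X.
Variables a b : nat -> R.
Hypothesis b_gt0 : forall n, (1 <= n)%N -> 0 < b n.
Local Notation Phi := (@gauss_cdf R).

(** The distribution function of a sum of n independent copies of X. *)
Definition sum_cdf (n : nat) : R -> R := iter n (shift_average P X) heaviside.
Local Notation F := sum_cdf.

Lemma sum_cdf_test n : test_function (F n).
Proof. exact/test_iter/heaviside_test. Qed.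

Lemma sum_cdf_mono n x y : x <= y -> F n x <= F n y.
Proof.
elim: n x y => [|n IH] x y xy.
  by rewrite /sum_cdf /= /heaviside ler_nat; case: (leP 0 x) => // x0; rewrite (le_trans x0 xy).
apply: le_Rintegral => //.
- exact: test_integrable (sum_cdf_test n).
- exact: test_integrable (sum_cdf_test n).
- by move=> t _; apply: IH; rewrite lerD2r.
Qed.

Hypothesis clt : forall x, F n (a n + b n * x) @[n --> \oo] --> Phi x.

Lemma sum_cdf_uniform (e : R) : 0 < e -> exists M : nat, (1 <= M)%N /\
  forall n, (M <= n)%N -> forall y, `|F n y - affine_gauss_cdf (a n) (b n) y| <= e.
Proof.
move=> e0; pose H n x := F n.+1 (a n.+1 + b n.+1 * x).
have [|||M hM] := @gauss_cdf_uniform_cvg R H _ _ _ e e0.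
- by move=> n x; exact: (sum_cdf_test n.+1).2.
- by move=> n x y xy; apply: sum_cdf_mono; rewrite lerD2l ler_pM2l// b_gt0.
- by move=> x; have := @clt x; rewrite -(cvg_shiftS (fun n => F n (a n + b n * x))).
exists M.+1; split=> // -[//|n]; rewrite ltnS => Mn y.
have b0 := @b_gt0 n.+1 isT.
have := hM n Mn ((y - a n.+1) / b n.+1); rewrite /H.
by have -> : a n.+1 + b n.+1 * ((y - a n.+1) / b n.+1) = y by field; rewrite gt_eqF.
Qed.

(** F (m + j) arises from F m by j convolutions with the law of X. Replace F m
    by its normal approximation, which commutes with these convolutions; they
    then produce F j, which is replaced in turn. *)
Lemma sum_cdf_add m j (e : R) : (1 <= m)%N -> (1 <= j)%N ->
    (forall y, `|F m y - affine_gauss_cdf (a m) (b m) y| <= e) ->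
    (forall y, `|F j y - affine_gauss_cdf (a j) (b j) y| <= e) ->
  forall y, `|F (m + j) y -
    affine_gauss_cdf (a m + a j) (Num.sqrt (b m ^+ 2 + b j ^+ 2)) y| <= 2 * e.
Proof.
move=> m1 j1 hm hj y.
have bm := b_gt0 m1; have bj := b_gt0 j1.
have h1 : `|F (m + j) y - iter j (shift_average P X) (affine_gauss_cdf (a m) (b m)) y| <= e.
  rewrite /sum_cdf addnC iterD; apply: iter_dist => //; first exact: sum_cdf_test.
  exact: affine_gauss_test.
have e1 : iter j (shift_average P X) (affine_gauss_cdf (a m) (b m)) y =
    gauss_average (a m) (b m) (F j) y.
  rewrite /sum_cdf -gauss_iter_comm//; last exact: heaviside_test.
  elim: j y {j1 hj bj h1} => [|j IH] y /=; first by rewrite gauss_average_heaviside.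
  exact: shift_average_ext.
have h2 : `|gauss_average (a m) (b m) (F j) y -
    gauss_average (a m) (b m) (affine_gauss_cdf (a j) (b j)) y| <= e.
  apply: shift_average_dist => //; first exact: measurable_idR.
    exact: sum_cdf_test.
  exact: affine_gauss_test.
rewrite gauss_average_gauss// in h2; rewrite e1 in h1.
by move: h1 h2 => /ler_normlP[? ?] /ler_normlP[? ?]; rewrite ler_norml; apply/andP; split; lra.
Qed.

(** F (m + j) has two normal approximations, with parameters (a m + a j, b m^2
    + b j^2) and (a (m + j), b (m + j)^2); [gauss_types] compares them. *)
Lemma clt_approx_add (e : R) : 0 < e -> exists M : nat, (1 <= M)%N /\
  forall m j, (M <= m)%N -> (M <= j)%N ->
    `|a (m + j)%N - a m - a j| <= e * b (m + j)%N /\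
    `|b m ^+ 2 + b j ^+ 2 - b (m + j)%N ^+ 2| <= e * b (m + j)%N ^+ 2.
Proof.
move=> e0; have [f [f0 fe f1]] : exists f : R, [/\ 0 < f, 3 * f <= e & f <= 1].
  exists (Num.min (e / 3) 1); rewrite lt_min !ge_min lexx orbT.
  split=> //; first by apply/andP; split; lra.
  by case: (leP (e / 3) 1) => ?; lra.
have [t t0 ht] := gauss_types f0.
have [|M [M1 hM]] := @sum_cdf_uniform (t / 3); first by lra.
exists M; split=> // m j Mm Mj.
have m1 : (1 <= m)%N by exact: leq_trans Mm.
have j1 : (1 <= j)%N by exact: leq_trans Mj.
have n1 : (1 <= m + j)%N by rewrite addn_gt0 m1.
have Mn : (M <= m + j)%N by rewrite (leq_trans Mm)// leq_addr.
have bm := b_gt0 m1; have bj := b_gt0 j1; have bn := b_gt0 n1.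
set s := Num.sqrt (b m ^+ 2 + b j ^+ 2).
have v0 : 0 < b m ^+ 2 + b j ^+ 2 by rewrite addr_gt0// exprn_gt0.
have s0 : 0 < s by rewrite sqrtr_gt0.
have s2 : s ^+ 2 = b m ^+ 2 + b j ^+ 2 by rewrite sqr_sqrtr// ltW.
have [] := ht ((a m + a j - a (m + j)%N) / b (m + j)%N) (s / b (m + j)%N).
  move=> z; pose y := a m + a j + s * z.
  have h1 := hM (m + j)%N Mn y.
  have h2 := sum_cdf_add m1 j1 (hM m Mm) (hM j Mj) y.
  have e1 : affine_gauss_cdf (a m + a j) s y = Phi z.
    by rewrite /affine_gauss_cdf /y; congr Phi; field; rewrite gt_eqF.
  have e2 : affine_gauss_cdf (a (m + j)%N) (b (m + j)%N) y =
      Phi ((a m + a j - a (m + j)%N) / b (m + j)%N + s / b (m + j)%N * z).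
    by rewrite /affine_gauss_cdf /y; congr Phi; field; rewrite gt_eqF.
  rewrite -/s e1 in h2; rewrite e2 in h1.
  by move: h1 h2 => /ler_normlP[? ?] /ler_normlP[? ?]; rewrite ler_norml; apply/andP; split; lra.
rewrite normrM normfV (gtr0_norm bn) ler_pdivrMr// => h1 h2; split.
  rewrite -normrN (_ : - (a (m + j)%N - a m - a j) = a m + a j - a (m + j)%N); last by ring.
  by apply: le_trans h1 _; rewrite ler_pM2r//; lra.
rewrite -s2; set r := s / b (m + j)%N in h2.
have -> : s = r * b (m + j)%N by rewrite /r divfK// gt_eqF.
have -> : (r * b (m + j)%N) ^+ 2 - b (m + j)%N ^+ 2 =
  (r - 1) * (r + 1) * b (m + j)%N ^+ 2 by ring.
rewrite normrM (ger0_norm (sqr_ge0 _)) ler_pM2r ?exprn_gt0// normrM.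
have : `|r + 1| <= 3.
  by move: h2 => /ler_normlP[? ?]; rewrite ler_norml; apply/andP; split; lra.
move=> h3; apply: (le_trans (y := f * 3)); last by lra.
by rewrite ler_pM.
Qed.

Lemma sum_cdf_linear_center : exists mu : R, forall e : R, 0 < e -> exists M : nat,
  (1 <= M)%N /\ forall n, (M <= n)%N -> forall y,
    `|F n y - Phi ((y - n%:R * mu) / b n)| <= e.
Proof.
have [mu hmu] := center_linear b_gt0 clt_approx_add.
exists mu => e e0.
have [|M1 [M11 h1]] := hmu (e / 18); first by lra.
have [|M2 [M21 h2]] := @sum_cdf_uniform (e / 2); first by lra.
exists (maxn M1 M2); split; first by rewrite leq_max M11.
move=> n; rewrite geq_max => /andP[n1 n2] y.
have bn := b_gt0 (leq_trans M11 n1).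
have := gauss_cdf_lipschitz ((y - n%:R * mu) / b n) ((y - a n) / b n).
rewrite -mulrBl (_ : y - a n - (y - n%:R * mu) = - (a n - n%:R * mu)); last by ring.
rewrite normrM normrN normfV (gtr0_norm bn) => h3.
have h4 : `|a n - n%:R * mu| / b n <= e / 18 by rewrite ler_pdivrMr//; exact: h1.
have := h2 n n2 y; rewrite /affine_gauss_cdf.
by move: h3 => /ler_normlP[? ?] /ler_normlP[? ?]; rewrite ler_norml; apply/andP; split; lra.
Qed.
End SumCdf.

(** * Mixing the partial sums over the number of records *)

Section Growth.
Context {R : realType}.

(** Compare the eighth powers: b^24 is at least c^3 x^9, against x^8 on the
    other side. *)
Lemma growth_negligible (c D e : R) : 0 < c -> 0 < e -> 0 <= D -> exists A : R,
  forall x b : R, A <= x -> 1 <= x -> 0 < b -> c * x ^+ 3 <= b ^+ 8 ->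
    D <= b /\ 27 * x * (D / b) ^+ 3 <= e.
Proof.
move=> c0 e0 D0.
exists (D ^+ 8 / c + (27 * D ^+ 3) ^+ 8 / (e ^+ 8 * c ^+ 3)).
have D80 : 0 <= D ^+ 8 / c by rewrite divr_ge0 ?exprn_ge0// ltW.
have E80 : 0 < e ^+ 8 * c ^+ 3 by rewrite mulr_gt0// exprn_gt0.
have D240 : 0 <= (27 * D ^+ 3) ^+ 8 / (e ^+ 8 * c ^+ 3).
  by rewrite divr_ge0 ?(ltW E80)// exprn_ge0// mulr_ge0// exprn_ge0.
move=> x b Ax x1 b0 h; have x0 : 0 < x by lra.
have x3 : x <= x ^+ 3.
  by rewrite -[leLHS]expr1; apply: ler_weXn2l.
split.
  rewrite -(@ler_pXn2r _ 8)// ?nnegrE ?(ltW b0)//; apply: le_trans h.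
  rewrite mulrC -ler_pdivrMr//; lra.
have b30 : 0 < b ^+ 3 by rewrite exprn_gt0.
rewrite expr_div_n mulrA ler_pdivrMr//.
have eb0 : 0 <= e * b ^+ 3 by rewrite mulr_ge0// ltW.
have xD0 : 0 <= 27 * x * D ^+ 3 by rewrite !mulr_ge0// ?exprn_ge0// ltW.
rewrite -(@ler_pXn2r _ 8)//.
have cb : c ^+ 3 * x ^+ 9 <= (b ^+ 3) ^+ 8.
  rewrite -exprM (exprM b 8 3) (exprM x 3 3) -exprMn.
  have h0 : 0 <= c * x ^+ 3 by rewrite mulr_ge0 ?exprn_ge0// ltW.
  by rewrite lerXn2r ?nnegrE// (le_trans h0 h).
apply: (le_trans (y := e ^+ 8 * (c ^+ 3 * x ^+ 9))); last first.
  by rewrite (exprMn _ e) ler_wpM2l// exprn_ge0// ltW.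
rewrite (_ : 27 * x * D ^+ 3 = x * (27 * D ^+ 3)); last by ring.
rewrite exprMn (exprSr x 8).
have -> : e ^+ 8 * (c ^+ 3 * (x ^+ 8 * x)) = x ^+ 8 * (x * (e ^+ 8 * c ^+ 3)) by ring.
by rewrite ler_pM2l ?exprn_gt0// -ler_pdivrMr//; lra.
Qed.
End Growth.

Section RecordSum.
Context {R : realType} d (T : measurableType d) (P : probability T R) (X : T -> R).
Hypothesis mX : measurable_fun setT X.
Variables a b : nat -> R.
Hypothesis b_gt0 : forall n, (1 <= n)%N -> 0 < b n.
Local Notation Phi := (@gauss_cdf R).
Local Notation F := (sum_cdf P X).
Hypothesis clt : forall x, F n (a n + b n * x) @[n --> \oo] --> Phi x.

(** The Chebyshev weight that dominates the indicator of the indices k far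
    from q. *)
Lemma sqr_dist_ge1 (K q k : nat) : (q < K * (k - q) \/ q < K * (q - k))%N -> (1 <= q)%N ->
  1 <= K%:R ^+ 2 / q%:R ^+ 2 * (k%:R - q%:R) ^+ 2 :> R.
Proof.
move=> h q1; have q0 : 0 < q%:R :> R by rewrite ltr0n.
rewrite -expr_div_n -exprMn mulrAC -real_normK ?num_real// exprn_ege1//.
rewrite normrM normfV (gtr0_norm q0) ler_pdivlMr// mul1r normrM ger0_norm//.
case: h => h.
  have kq : (q <= k)%N by lia.
  by rewrite -natrB// ger0_norm// -natrM ler_nat ltnW.
have kq : (k <= q)%N by lia.
by rewrite distrC -natrB// ger0_norm// -natrM ler_nat ltnW.
Qed.

Lemma near_index (K q k M : nat) :
    (K.+2 * (k - q) <= q)%N -> (K.+2 * (q - k) <= q)%N -> (2 * M <= q)%N ->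
  [/\ (K * (k - q) <= q), (K * (q - k) <= q) & (M <= k)]%N.
Proof. by rewrite !mulSn => h1 h2 h3; split; lia. Qed.

(** At a point z the difference of F k.+1 z and Phi ((z - mu (k + 1)) / b q)
    is at most 19 f for k + 1 near q, and at most 1 elsewhere, where the
    Chebyshev weight exceeds 1. Averaging over the number of records and
    applying [record_lindeberg] leaves Phi x. *)
Lemma record_sum_limit : exists a' b' : nat -> R, (forall m, 0 < b' m) /\
  forall x, record_mean m (fun k => F k.+1 (a' m + b' m * x)) @[m --> \oo] --> Phi x.
Proof.
have [mu hmu] := sum_cdf_linear_center mX b_gt0 clt.
have addab := clt_approx_add mX b_gt0 clt.
(* q is at least 1 and within 1 of the expected value of D. *)
pose q m := (Num.truncn (@record_expect R m)).+1.
have q_gt m : record_expect m < (q m)%:R :> R by exact: truncnS_gt.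
have q_le m : (q m)%:R <= record_expect m + 1 :> R.
  by rewrite -natr1 lerD2r truncn_le record_expect_ge0.
pose B m := Num.sqrt (b (q m) ^+ 2 + mu ^+ 2 * record_var m).
have B0 m : 0 < B m.
  rewrite sqrtr_gt0; apply: ltr_wpDr; last by rewrite exprn_gt0// b_gt0.
  by rewrite mulr_ge0 ?sqr_ge0// record_var_ge0.
exists (fun m => mu * (record_expect m + 1)), B; split=> // x.
apply/cvgrPdist_le => e e0.
have [f [f0 fe f2]] : exists f : R, [/\ 0 < f, 57 * f <= e & f <= 2^-1].
  exists (Num.min (e / 57) 2^-1); rewrite lt_min !ge_min lexx orbT.
  split=> //; first by apply/andP; split; lra.
  by case: (leP (e / 57) 2^-1) => ?; lra.
have [K [M1 [M11 h1]]] := scale_ratio b_gt0 addab f0.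
have [M2 [M21 h2]] := hmu f f0.
have [c [M3 [c0 M31 h3]]] := scale_growth b_gt0 addab.
have [|A hA] := growth_negligible c0 (e := e / 3) _ (normr_ge0 mu); first by lra.
(* With a factor at least 2 the condition K' |k + 1 - q| <= q forces k + 1 >=
   q / 2, which makes k + 1 large as well. *)
pose K' := K.+2.
(* The term 6 K'^2 / e makes the averaged Chebyshev weight, at most 2 K'^2 /
   q, smaller than e / 3. *)
pose A' := Num.max A (Num.max (6 * K'%:R ^+ 2 / e) (M1 + 2 * M2 + M3)%N%:R).
have [M hM] := record_expect_infty A'.
exists M => // m /hM Am.
have qA : A <= (q m)%:R.
  by apply: le_trans (ltW (q_gt m)); apply: le_trans Am; rewrite le_max lexx.
have qK : 6 * K'%:R ^+ 2 / e <= (q m)%:R.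
  by apply: le_trans (ltW (q_gt m)); apply: le_trans Am; rewrite !le_max lexx orbT.
have qM : (M1 + 2 * M2 + M3 <= q m)%N.
  rewrite -(ler_nat R).
  by apply: le_trans (ltW (q_gt m)); apply: le_trans Am; rewrite !le_max lexx !orbT.
have qM1 : (M1 <= q m)%N by apply: leq_trans qM; rewrite -addnA leq_addr.
have qM2 : (2 * M2 <= q m)%N by apply: leq_trans qM; rewrite addnAC leq_addl.
have qM3 : (M3 <= q m)%N by apply: leq_trans qM; rewrite leq_addl.
have q1 : (1 <= q m)%N by [].
set n := q m in qA qK qM1 qM2 qM3 q1 *.
have bn := b_gt0 q1.
have n1 : 1 <= n%:R :> R by rewrite ler1n.
have n0 : 0 < n%:R :> R by lra.
have [mub small] := hA n%:R (b n) qA n1 bn (h3 n qM3).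
pose y := mu * (record_expect m + 1) + B m * x.
have -> : Phi x = Phi ((y - mu - mu * record_expect m) / B m).
  by congr Phi; rewrite /y; field; rewrite gt_eqF.
have lind := record_lindeberg m (y - mu) bn mub.
rewrite -/(B m) in lind.
set G := Phi _ in lind *; set E1 := record_mean m _ in lind.
have lind_le : 27 * record_expect m * (`|mu| / b n) ^+ 3 <= e / 3.
  apply: le_trans small; rewrite ler_wpM2r// ?exprn_ge0 ?divr_ge0 ?ler_wpM2l ?(ltW bn)//.
  exact: ltW.
pose err (k : nat) : R := 19 * f * 1 + K'%:R ^+ 2 / n%:R ^+ 2 * (k%:R - (n%:R - 1)) ^+ 2.
have point k : `|F k.+1 y - Phi ((y - mu - mu * k%:R) / b n)| <= err k.
  have tail0 : 0 <= K'%:R ^+ 2 / n%:R ^+ 2 * (k%:R - (n%:R - 1)) ^+ 2 :> R.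
    by rewrite mulr_ge0 ?sqr_ge0// divr_ge0 ?sqr_ge0.
  have [near|far] := boolP ((K' * (k.+1 - n) <= n) && (K' * (n - k.+1) <= n))%N.
    have [k1 k2 kM2] : [/\ (K * (k.+1 - n) <= n), (K * (n - k.+1) <= n) & (M2 <= k.+1)]%N.
      by case/andP: near => n1' n2'; exact: near_index.
    have r := h1 n k.+1 qM1 k1 k2.
    have lin := h2 k.+1 kM2 y.
    have bk := b_gt0 (leq_trans M21 kM2).
    have /ler_normlP[r1 r2] := r.
    have := @gauss_cdf_scale _ (b k.+1 / b n) ((y - k.+1%:R * mu) / b k.+1) _.
    rewrite (_ : b k.+1 / b n * ((y - k.+1%:R * mu) / b k.+1) =
      (y - mu - mu * k%:R) / b n); last first.
      by rewrite -natr1; field; rewrite !gt_eqF.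
    move=> h4; have {}h4 := h4 ltac:(lra).
    have : 18 * `|b k.+1 / b n - 1| <= 18 * f by rewrite ler_wpM2l.
    rewrite /err; move: lin h4 tail0 => /ler_normlP[? ?] /ler_normlP[? ?] ? ?.
    by rewrite ler_norml; apply/andP; split; lra.
  have : 1 <= K'%:R ^+ 2 / n%:R ^+ 2 * (k.+1%:R - n%:R) ^+ 2 :> R.
    apply: sqr_dist_ge1 => //; apply/orP; move: far; rewrite negb_and -!ltnNge //.
  rewrite (_ : k.+1%:R - n%:R = k%:R - (n%:R - 1)); last by rewrite -natr1; ring.
  have /andP[F0 F1] := (sum_cdf_test P mX k.+1).2 y.
  have P0 := gauss_cdf_ge0 ((y - mu - mu * k%:R) / b n).
  have P1 := gauss_cdf_le1 ((y - mu - mu * k%:R) / b n).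
  move=> h; rewrite /err ler_norml; apply/andP; split; lra.
have := record_mean_dist m point; rewrite -/E1 => H1.
have errE : record_mean m err <= 2 * e / 3.
  rewrite /err record_mean_lin record_mean_cst record_mean_sqr.
  have v1 := @record_var_le R m.
  have g1 := q_gt m; have g2 := q_le m; rewrite -/n in g1 g2.
  have sq : (record_expect m - (n%:R - 1)) ^+ 2 <= 1 :> R.
    by rewrite -real_normK ?num_real// expr_le1// ler_norml; apply/andP; split; lra.
  set w : R := K'%:R ^+ 2 / n%:R ^+ 2.
  have w0 : 0 <= w by rewrite divr_ge0 ?sqr_ge0.
  have : w * (record_var m + (record_expect m - (n%:R - 1)) ^+ 2) <= w * (2 * n%:R).
    by apply: ler_wpM2l => //; lra.
  have -> : w * (2 * n%:R) = 2 * K'%:R ^+ 2 / n%:R by rewrite /w; field; rewrite gt_eqF.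
  have : 2 * K'%:R ^+ 2 / n%:R <= e / 3.
    by rewrite ler_pdivrMr//; move: qK; rewrite ler_pdivrMr//; lra.
  lra.
move: lind H1 => /ler_normlP[? ?] /ler_normlP[? ?].
by rewrite ler_norml; apply/andP; split; lra.
Qed.
End RecordSum.

(** * The laws of the partial sums and of the walk *)

Section JointLaw.
Context d (T : measurableType d) (R : realType) (P : probability T R).

Lemma probability_fin_num (A : set T) : measurable A -> P A \is a fin_num.
Proof. by move=> mA; rewrite fin_num_measure. Qed.

(** Where E has positive probability, the conditional joint law of V and Y
    given E is a measure that agrees with the product law on rectangles. *)
Lemma joint_law (V Y : {RV P >-> R}) (E : set T) : measurable E ->
    (forall A B, measurable A -> measurable B ->
      P (V @^-1` A `&` Y @^-1` B `&` E) = (P (V @^-1` A) * P (Y @^-1` B) * P E)%E) ->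
  forall C : set (R * R), measurable C ->
    P ((fun t => (V t, Y t)) @^-1` C `&` E) =
    ((distribution P V \x distribution P Y) C * P E)%E.
Proof.
move=> mE h C mC.
have mp : measurable_fun setT (fun t => (V t, Y t)) by exact: measurable_fun_pair.
have mpC C' : measurable C' -> measurable ((fun t => (V t, Y t)) @^-1` C').
  by move=> mC'; rewrite -[X in measurable X]setTI; exact: mp.
have PE : P E = (fine (P E))%:E by rewrite fineK// probability_fin_num.
have [PE0|PE0] := eqVneq (P E) 0%E.
  rewrite PE0 mule0; apply/eqP; rewrite -measure_le0 -PE0.
  by apply: le_measure; rewrite ?inE//; apply: measurableI => //; exact: mpC.
pose q := fine (P E).
have q0 : 0 < q by rewrite fine_gt0// lt0e PE0 measure_ge0 ltey_eq probability_fin_num.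
have q1 : 0 <= q^-1 by rewrite invr_ge0 ltW.
pose m0 : {measure set (R * R)%type -> \bar R} :=
  @measure_function_pushforward__canonical__measure_function_Measure _ _ _ _ _
    (mrestr P mE) _ mp.
pose m := mscale (NngNum q1) m0.
have mE' C' : m C' = (q^-1%:E * P ((fun t => (V t, Y t)) @^-1` C' `&` E))%E.
  by [].
have <- : m C = (distribution P V \x distribution P Y)%E C.
  apply/esym; apply: product_measure_unique => // A B mA mB.
  apply: (etrans (mE' (A `*` B))).
  rewrite (_ : _ @^-1` (A `*` B) = V @^-1` A `&` Y @^-1` B)//.
  rewrite h// muleC -muleA [X in (_ * X)%E](_ : _ = 1%E) ?mule1//.
  by rewrite PE -EFinM divff// gt_eqF.
by rewrite mE' muleC muleA PE -EFinM divff ?mul1e// gt_eqF.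
Qed.

Lemma joint_law_add (V Y : {RV P >-> R}) (z : R) :
  (distribution P V \x distribution P Y)%E [set p : R * R | p.1 + p.2 <= z] =
  (\int[distribution P Y]_y P (V @^-1` `]-oo, (z - y)%R]))%E.
Proof.
rewrite (@product_measure_unique _ _ _ _ _ _ _ (distribution P V \x^ distribution P Y)%E).
- apply: eq_integral => y _ /=; congr (P _); apply/seteqP; split=> t /=.
    by move/ysectionP => /=; rewrite in_itv/= lerBrDr.
  by rewrite in_itv/= lerBrDr => ?; apply/ysectionP.
- by move=> A B mA mB; exact: product_measure2E.
- have mf : measurable_fun setT (fun p : R * R => p.1 + p.2) by exact: measurable_funD.
  rewrite (_ : [set _ | _] = (fun p : R * R => p.1 + p.2) @^-1` `]-oo, z]).
    by rewrite -[X in measurable X]setTI; exact: mf.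
  by apply/seteqP; split=> p /=; rewrite in_itv.
Qed.

(** Almost sure decomposition of an event, stated through indicators so that
    the exceptional set of the hypothesis is absorbed by the integral. *)
Lemma ae_finite_partition (n : nat) (S : set T) (Q : nat -> set T) :
    measurable S -> (forall j, measurable (Q j)) ->
    {ae P, forall t, ((\1_S t)%:E = \sum_(j < n) (\1_(Q j) t)%:E :> \bar R)%E} ->
  P S = (\sum_(j < n) P (Q j))%E.
Proof.
move=> mS mQ h.
have e1 A : measurable A -> P A = (\int[P]_t (\1_A t)%:E)%E.
  by move=> mA; rewrite integral_indic// setIT.
rewrite e1//; under eq_bigr do rewrite e1//.
rewrite -ge0_integral_sum//; last first.
  by move=> j; apply/measurable_EFinP; exact: measurable_indic.
apply: ae_eq_integral => //.
- by apply/measurable_EFinP; exact: measurable_indic.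
- by apply: emeasurable_sum => j; apply/measurable_EFinP; exact: measurable_indic.
- by apply: filterS h => t h _.
Qed.
Lemma measurable_preimage d' (T' : measurableType d') (V : {RV P >-> T'}) (A : set T') :
  measurable A -> measurable (V @^-1` A).
Proof. by move=> mA; rewrite -[X in measurable X]setTI; exact: measurable_funPT. Qed.

(** The event that V 1, ..., V n lie in A 0, ..., A n.-1 respectively. *)
Fixpoint box d' (T' : measurableType d') (V : nat -> {RV P >-> T'}) (n : nat)
    (A : nat -> set T') : set T :=
  if n is n'.+1 then box V n' A `&` V n @^-1` A n' else setT.

Lemma box_ext d' (T' : measurableType d') (V : nat -> {RV P >-> T'}) n A B :
  (forall i, (i < n)%N -> A i = B i) -> box V n A = box V n B.
Proof.
elim: n => //= n IH AB; rewrite AB// IH// => i iN; exact/AB/ltnW.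
Qed.

Lemma box_generated d' (T' : measurableType d') (V : nat -> {RV P >-> T'}) n A :
    (forall i, measurable (A i)) ->
  generated_sigma_algebra [set n | (1 <= n)%N] V (box V n A).
Proof.
move=> mA; rewrite /generated_sigma_algebra; set GG := (X in <<s X >>).
have sub i : (1 <= i)%N -> forall B, measurable B -> <<s GG >> (V i @^-1` B).
  move=> i1 B mB; apply: sub_sigma_algebra; exists i => //.
  by exists B => //; rewrite setTI.
elim: n => [|n IH] /=; first exact: (@measurableT _ (g_sigma_algebraType GG)).
exact: (@measurableI _ (g_sigma_algebraType GG) _ _ IH (sub n.+1 isT _ (mA n))).
Qed.

Lemma box_probability d' (T' : measurableType d') (V : nat -> {RV P >-> T'}) n A :
    mutually_independent [set n | (1 <= n)%N] V -> (forall i, measurable (A i)) ->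
  P (box V n A) = (\prod_(i < n) P (V i.+1 @^-1` A i))%E.
Proof.
move=> V_indep mA.
pose J : {fset nat} := [fset i in iota 1 n]%fset.
have := V_indep J (fun i => A i.-1) _ (fun i _ => mA _).
have -> : \bigcap_(i in [set` J]) V i @^-1` A i.-1 = box V n A.
  apply/seteqP; split=> t.
    move=> h; have {}h i : (i < n)%N -> A i (V i.+1 t).
      by move=> iN; apply: (h i.+1); rewrite /= !inE mem_iota.
    elim: n {J} h => //= n IH h; split; last exact: h.
    by apply: IH => i iN; exact/h/ltnW.
  move=> h i /=; rewrite !inE mem_iota => /andP[i1].
  case: i i1 => // i _; rewrite add1n ltnS => iN /=.
  elim: n {J} h iN => //= n IH [h1 h2]; rewrite ltnS leq_eqVlt => /predU1P[->//|].
  exact: IH.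
move=> ->.
  rewrite (perm_big (iota 1 n)); last first.
    by apply: uniq_perm; rewrite ?fset_uniq ?iota_uniq// => i; rewrite !inE.
  by rewrite (_ : iota 1 n = index_iota 1 n.+1) ?big_add1 ?big_mkord// /index_iota subn1.
by move=> i /=; rewrite !inE mem_iota => /andP[].
Qed.

Lemma ae_probability_eq (S S' : set T) : measurable S -> measurable S' ->
  {ae P, forall t, S t <-> S' t} -> P S = P S'.
Proof.
move=> mS mS' h; rewrite (@ae_finite_partition 1 S (fun=> S'))// ?big_ord1//.
apply: filterS h => t h; rewrite big_ord1 !indicE; congr (_%:R%:E); congr nat_of_bool.
by apply/idP/idP; rewrite !inE => /h.
Qed.

End JointLaw.

Section Walk.
Context d (T : measurableType d) (R : realType) (P : probability T R).
Variables (U : nat -> {RV P >-> nat}) (X W : nat -> {RV P >-> R}).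
Hypothesis U_indep : mutually_independent [set n | (1 <= n)%N] U.
Hypothesis U_unif : forall n, (1 <= n)%N -> uniform_on_1_to n (U n).
Hypothesis X_indep : mutually_independent [set n | (1 <= n)%N] X.
Hypothesis X_ident : identically_distributed [set n | (1 <= n)%N] X.
Hypothesis XU_indep : independent_families [set n | (1 <= n)%N] X U.
Hypothesis W_walk : uniformly_reverting_walk U X W.

(** E is independent of X 1, ..., X n, U 1, ..., U n, expressed on boxes. *)
Definition independent_of_past (n : nat) (E : set T) : Prop :=
  measurable E /\ forall (A : nat -> set R) (B : nat -> set nat),
    (forall i, measurable (A i)) -> (forall i, measurable (B i)) ->
    P (box X n A `&` box U n B `&` E) =
    (\prod_(i < n) P (X i.+1 @^-1` A i) * \prod_(i < n) P (U i.+1 @^-1` B i) * P E)%E.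

Lemma independent_of_past_setT n : independent_of_past n setT.
Proof.
split=> // A B mA mB; rewrite setIT probability_setT mule1.
rewrite XU_indep; [|exact: box_generated|exact: box_generated].
by rewrite !box_probability.
Qed.

(** Peeling off the last coordinates: an event independent of the first n + 1
    steps stays independent of the first n after intersection with conditions
    on X n.+1 and U n.+1. *)
Lemma independent_of_past_step n E (A : set R) (B : set nat) :
    independent_of_past n.+1 E -> measurable A -> measurable B ->
  independent_of_past n (X n.+1 @^-1` A `&` U n.+1 @^-1` B `&` E) /\
  P (X n.+1 @^-1` A `&` U n.+1 @^-1` B `&` E) =
    (P (X n.+1 @^-1` A) * P (U n.+1 @^-1` B) * P E)%E.
Proof.
move=> [mE h] mA mB.
have mXU : measurable (X n.+1 @^-1` A `&` U n.+1 @^-1` B `&` E).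
  by do 2 apply: measurableI => //; exact: measurable_preimage.
have key A' B' : (forall i, measurable (A' i)) -> (forall i, measurable (B' i)) ->
    P (box X n A' `&` box U n B' `&` (X n.+1 @^-1` A `&` U n.+1 @^-1` B `&` E)) =
    (\prod_(i < n) P (X i.+1 @^-1` A' i) * \prod_(i < n) P (U i.+1 @^-1` B' i) *
     (P (X n.+1 @^-1` A) * P (U n.+1 @^-1` B) * P E))%E.
  move=> mA' mB'.
  pose A2 i := if i == n then A else A' i.
  pose B2 i := if i == n then B else B' i.
  have mA2 i : measurable (A2 i) by rewrite /A2; case: ifP.
  have mB2 i : measurable (B2 i) by rewrite /B2; case: ifP.
  have := h A2 B2 mA2 mB2; rewrite /= !big_ord_recr /=.
  have eA : box X n A2 = box X n A'.
    by apply: box_ext => i iN; rewrite /A2 ltn_eqF.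
  have eB : box U n B2 = box U n B'.
    by apply: box_ext => i iN; rewrite /B2 ltn_eqF.
  rewrite eA eB {1 3}/A2 {1 3}/B2 eqxx.
  under eq_bigr => i _ do rewrite /A2 ltn_eqF//.
  under [X in (_ * (X * _) * _)%E]eq_bigr => i _ do rewrite /B2 ltn_eqF//.
  move=> e; rewrite [LHS](_ : _ = P (box X n A' `&` X n.+1 @^-1` A `&`
      (box U n B' `&` U n.+1 @^-1` B) `&` E)); last first.
    by congr (P _); apply/seteqP; split => t /=; tauto.
  by rewrite e !muleA; congr (_ * _)%E; rewrite -!muleA; congr (_ * _)%E; rewrite muleCA.
have PXU : P (X n.+1 @^-1` A `&` U n.+1 @^-1` B `&` E) =
    (P (X n.+1 @^-1` A) * P (U n.+1 @^-1` B) * P E)%E.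
  have := key (fun=> setT) (fun=> setT) (fun=> measurableT) (fun=> measurableT).
  have bT d' (T' : measurableType d') (V : nat -> {RV P >-> T'}) :
      box V n (fun=> setT) = setT.
    by elim: n {h mXU key} => //= n ->; rewrite setTI preimage_setT.
  rewrite !bT !setTI => ->.
  rewrite !big1 ?mul1e// => i _; by rewrite preimage_setT probability_setT.
by split=> //; split=> // A' B' mA' mB'; rewrite PXU; exact: key.
Qed.

Lemma independent_of_past_pred n E :
  independent_of_past n.+1 E -> independent_of_past n E.
Proof.
move=> h; have [] := independent_of_past_step h measurableT measurableT.
by rewrite !preimage_setT !setTI.
Qed.

Lemma independent_of_past_le m n E : (m <= n)%N ->
  independent_of_past n E -> independent_of_past m E.
Proof.
move=> /subnK <-; elim: (n - m)%N => // k IH; rewrite addSn.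
by move=> /independent_of_past_pred.
Qed.

(** The consequence of V being a function of the first n steps that the
    induction uses; quantifying over all E replaces a measurability argument
    with respect to the past. *)
Definition past_determined (n : nat) (V : {RV P >-> R}) : Prop :=
  forall E A, independent_of_past n E -> measurable A ->
    P (V @^-1` A `&` E) = (P (V @^-1` A) * P E)%E.

(** By [independent_of_past_step] the hypothesis of [joint_law] holds with the
    event that U n.+1 lies in B and E occurs. *)
Lemma add_increment (n m : nat) (V : {RV P >-> R}) E (B : set nat) (C : set (R * R)) :
    past_determined m V -> (m <= n)%N -> independent_of_past n.+1 E ->
    measurable B -> measurable C ->
  P ((fun t => (V t, X n.+1 t)) @^-1` C `&` (U n.+1 @^-1` B `&` E)) =
  ((distribution P V \x distribution P (X n.+1)) C * (P (U n.+1 @^-1` B) * P E))%E.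
Proof.
move=> detV mn indE mB mC.
have [indT PT] := independent_of_past_step indE measurableT mB.
have PUE : P (U n.+1 @^-1` B `&` E) = (P (U n.+1 @^-1` B) * P E)%E.
  by move: PT; rewrite preimage_setT setTI probability_setT mul1e.
rewrite joint_law ?PUE//.
  by apply: measurableI; [exact: measurable_preimage|exact: indE.1].
move=> A A' mA mA'.
have [ind1 P1] := independent_of_past_step indE mA' mB.
rewrite -setIA [X in P (_ `&` X)](_ : _ = X n.+1 @^-1` A' `&` U n.+1 @^-1` B `&` E); last first.
  by rewrite setIA.
rewrite detV ?P1//; last exact: independent_of_past_le mn ind1.
by rewrite !muleA.
Qed.

Lemma past_determined0 (V : {RV P >-> R}) :
  {ae P, forall t, V t = 0} -> past_determined 0 V.
Proof.
move=> V0 E A [mE _] mA.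
have mS : measurable [set t : T | A 0].
  have [A0|A0] := pselect (A 0).
    by rewrite (_ : mkset _ = setT)//; apply/seteqP; split.
  by rewrite (_ : mkset _ = set0)//; apply/seteqP; split.
have e1 : P (V @^-1` A) = P [set t : T | A 0].
  apply: ae_probability_eq => //; first exact: measurable_preimage.
  by apply: filterS V0 => t /= ->.
have -> : P (V @^-1` A `&` E) = P ([set t : T | A 0] `&` E).
  apply: ae_probability_eq.
  - by apply: measurableI => //; exact: measurable_preimage.
  - exact: measurableI.
  - by apply: filterS V0 => t /= ->.
rewrite e1; have [A0|A0] := pselect (A 0).
  by rewrite (_ : mkset _ = setT) ?setTI ?probability_setT ?mul1e//; apply/seteqP; split.
by rewrite (_ : mkset _ = set0) ?set0I ?measure0 ?mul0e//; apply/seteqP; split.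
Qed.

Definition sum_in (A : set R) : set (R * R) := (fun p => p.1 + p.2) @^-1` A.

Lemma measurable_sum_in A : measurable A -> measurable (sum_in A).
Proof.
move=> mA; have mf : measurable_fun setT (fun p : R * R => p.1 + p.2) by exact: measurable_funD.
by rewrite /sum_in -[X in measurable X]setTI; exact: mf.
Qed.

Local Notation cdfV V := (shift_average P V heaviside).

(** By identical distribution, adding any increment X n.+1 to V acts on
    distribution functions as the convolution with the law of X 1. *)
Lemma joint_cdf (V : {RV P >-> R}) n z :
  ((distribution P V \x distribution P (X n.+1)) (sum_in `]-oo, z]) =
   (shift_average P (X 1%N) (cdfV V) z)%:E)%E.
Proof.
have tV : test_function (cdfV V) by apply: shift_average_test => //; exact: heaviside_test.
rewrite (_ : sum_in _ = [set p : R * R | p.1 + p.2 <= z]); last first.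
  by apply/seteqP; split=> p; rewrite /sum_in /= in_itv.
rewrite joint_law_add (eq_measure_integral (distribution P (X 1%N))); last first.
  by move=> A mA _; exact: X_ident.
rewrite shift_averageE//.
under eq_integral do rewrite -shift_average_heaviside//.
rewrite ge0_integral_distribution//.
- apply/measurable_EFinP; apply: measurableT_comp; first exact: tV.1.
  exact: measurable_funB.
- by move=> y; rewrite lee_fin; case/andP: (tV.2 (z - y)).
Qed.

Fixpoint partial_sum (n : nat) : {RV P >-> R} :=
  if n is m.+1 then (partial_sum m : {mfun T >-> R}) + X m.+1 else (0 : {mfun T >-> R}).

Lemma partial_sumE n t : partial_sum n t = \sum_(1 <= k < n.+1) X k t.
Proof.
elim: n => [|n IH]; first by rewrite big_geq.
by rewrite big_nat_recr//= -IH.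
Qed.

Lemma partial_sum_step n E A : past_determined n (partial_sum n) ->
    independent_of_past n.+1 E -> measurable A ->
  P (partial_sum n.+1 @^-1` A `&` E) =
  ((distribution P (partial_sum n) \x distribution P (X n.+1)) (sum_in A) * P E)%E.
Proof.
move=> det indE mA.
have := add_increment det (leqnn n) indE measurableT (measurable_sum_in mA).
by rewrite preimage_setT setTI probability_setT mul1e.
Qed.

Lemma partial_sum_past n : past_determined n (partial_sum n).
Proof.
elim: n => [|n IH]; first by apply: past_determined0; apply: aeW.
move=> E A indE mA.
rewrite (partial_sum_step IH indE mA).
have := partial_sum_step IH (independent_of_past_setT n.+1) mA.
by rewrite setIT probability_setT mule1 => ->.
Qed.

Lemma partial_sum_cdf n : cdfV (partial_sum n) =1 sum_cdf P (X 1%N) n.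
Proof.
elim: n => [|n IH] z.
  apply: EFin_inj; rewrite shift_averageE//; last exact: heaviside_test.
  under eq_integral do rewrite subr0.
  by rewrite integral_cst//= probability_setT mule1.
rewrite /sum_cdf /= -/(sum_cdf P (X 1%N) n) -(shift_average_ext P (X 1%N) IH).
apply: EFin_inj; rewrite -(joint_cdf _ n) shift_average_heaviside//.
have := partial_sum_step (@partial_sum_past n) (independent_of_past_setT n.+1)
  (measurable_itv `]-oo, z]).
by rewrite setIT probability_setT mule1 => ->.
Qed.

Lemma uniform_ae n : (1 <= n)%N -> {ae P, forall t, (1 <= U n t <= n)%N}.
Proof.
move=> n1; have := U_unif n1 => h.
have : P.-negligible (\bigcup_k (U n @^-1` (if (1 <= k <= n)%N then set0 else [set k]))).
  apply: negligible_bigcup => k.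
  case: ifPn => kn; first by rewrite preimage_set0; exact: negligible_set0.
  apply/negligibleP; first exact: measurable_preimage.
  by have := h k; rewrite (negbTE kn).
apply: negligibleS => t /= Ut; exists (U n t) => //=.
by move/negP/negbTE: Ut => ->.
Qed.

(** Decompose according to the value j.+1 of U n.+1, which has probability 1 /
    n.+1 and is independent of W j.+1 and of X n.+1. *)
Lemma walk_step n E A :
    (forall j, (j <= n)%N -> past_determined j (W j.+1)) ->
    independent_of_past n.+1 E -> measurable A ->
  P (W n.+2 @^-1` A `&` E) =
  ((\sum_(j < n.+1) (distribution P (W j.+1) \x distribution P (X n.+1)) (sum_in A) *
     (n.+1%:R^-1)%:E) * P E)%E.
Proof.
move=> det indE mA.
pose Q (j : nat) := (fun t => (W j.+1 t, X n.+1 t)) @^-1` (sum_in A) `&`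
  (U n.+1 @^-1` [set j.+1] `&` E).
have mQ j : measurable (Q j).
  apply: measurableI.
    have mp : measurable_fun setT (fun t => (W j.+1 t, X n.+1 t)) by exact: measurable_fun_pair.
    by rewrite -[X in measurable X]setTI; apply: mp => //; exact: measurable_sum_in.
  by apply: measurableI; [exact: measurable_preimage|exact: indE.1].
rewrite (@ae_finite_partition _ _ _ P n.+1 _ Q)//.
- rewrite ge0_sume_distrl; last by move=> j _; rewrite mule_ge0// lee_fin invr_ge0.
  apply: eq_bigr => j _; have jn : (j <= n)%N by rewrite -ltnS.
  rewrite /Q (add_increment (det j jn) jn indE)//; last exact: measurable_sum_in.
  rewrite muleA; congr (_ * _ * _)%E.
  have := @U_unif n.+1 isT j.+1; rewrite /distribution /pushforward => ->.
  by rewrite /= ltnS jn.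
- by apply: measurableI; [exact: measurable_preimage|exact: indE.1].
have n1 : (1 <= n.+1)%N by [].
have := W_walk.2 n.+1 n1; have := uniform_ae n1.
apply: filterS2 => t /andP[U1 Un] Wt.
have [j Uj] : exists j : 'I_n.+1, U n.+1 t = j.+1.
  have jP : ((U n.+1 t).-1 < n.+1)%N by rewrite prednK.
  by exists (Ordinal jP); rewrite /= prednK.
rewrite (bigD1 j)//= big1 ?adde0; last first.
  move=> i ij; rewrite indicE memNset// => -[_ [/= Ui _]].
  by move/eqP: ij; apply; apply: val_inj; move: Ui; rewrite Uj => -[].
congr EFin; rewrite !indicE; congr (_%:R); congr nat_of_bool.
apply/idP/idP; rewrite !inE /Q /sum_in /= Wt Uj.
  by move=> [].
by move=> [? []].
Qed.

(** [walk_step] applied to E and to the whole space gives the same factor. *)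
Lemma walk_past n : past_determined n (W n.+1).
Proof.
have [m] := ubnP n; elim: m n => // m IH [|n] nm; first exact: past_determined0 W_walk.1.
have det j : (j <= n)%N -> past_determined j (W j.+1).
  by move=> jn; apply: IH; apply: leq_ltn_trans jn _; rewrite -ltnS.
move=> E A indE mA; rewrite (walk_step det indE mA).
have := walk_step det (independent_of_past_setT n.+1) mA.
by rewrite setIT probability_setT mule1 => ->.
Qed.

Lemma walk_cdf0 : cdfV (W 1%N) =1 heaviside.
Proof.
move=> z; apply: EFin_inj; rewrite shift_averageE//; last exact: heaviside_test.
transitivity (\int[P]_t (cst (heaviside z)%:E t))%E.
  apply: ae_eq_integral => //.
    by apply/measurable_EFinP; apply: test_measurable => //; exact: heaviside_test.
  by apply: filterS W_walk.1 => t -> _; rewrite subr0.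
by rewrite integral_cst//= probability_setT mule1.
Qed.

Lemma walk_cdfS n z : cdfV (W n.+2) z =
  (\sum_(j < n.+1) shift_average P (X 1%N) (cdfV (W j.+1)) z) / n.+1%:R.
Proof.
apply: EFin_inj; rewrite shift_average_heaviside//.
have := walk_step (fun j _ => @walk_past j) (independent_of_past_setT n.+1)
  (measurable_itv `]-oo, z]).
rewrite setIT probability_setT mule1 => ->.
rewrite mulr_suml -sumEFin; apply: eq_bigr => j _.
by rewrite joint_cdf EFinM.
Qed.

Local Notation F := (sum_cdf P (X 1%N)).

Lemma shift_average_record_mean m (f : nat -> R -> R) z : (forall k, test_function (f k)) ->
  shift_average P (X 1%N) (fun y => record_mean m (fun k => f k y)) z =
  record_mean m (fun k => shift_average P (X 1%N) (f k) z).
Proof.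
elim: m f => [//|m IH] f tf /=.
rewrite (IH (fun k y => (1 - inv_rank m) * f k y + inv_rank m * f k.+1 y)).
  by apply: eq_record_mean => k; rewrite shift_average_convex.
move=> k; have /andP[p0 p1] := @inv_rank_itv R m.
by apply: test_convex => //; [exact: ltW|lra].
Qed.

(** The sum over j satisfies s (n + 1) = s n + T (s n / (n + 1)), where T is
    the convolution with the law of X 1, while T maps F k to F k.+1 and
    commutes with [record_mean n]; this is the recursion that defines
    [record_mean]. *)
Lemma walk_cdf_sum n z :
  \sum_(j < n.+1) shift_average P (X 1%N) (cdfV (W j.+1)) z =
  n.+1%:R * record_mean n (fun k => F k.+1 z).
Proof.
elim: n z => [|n IH] z.
  by rewrite big_ord1 mul1r /= (shift_average_ext _ _ walk_cdf0).
rewrite big_ord_recr /= IH.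
have e : cdfV (W n.+2) =1 (fun y => record_mean n (fun k => F k.+1 y)).
  by move=> y; rewrite walk_cdfS IH mulrC mulKf// pnatr_eq0.
rewrite (shift_average_ext _ _ e) (@shift_average_record_mean n (fun k y => F k.+1 y)); last first.
  by move=> k; exact: sum_cdf_test.
rewrite record_mean_lin /inv_rank -/(F _) [record_mean n (fun k => shift_average _ _ _ _)](_ : _ =
  record_mean n (fun k => F k.+2 z))//.
by rewrite -!natr1; field; rewrite !natr1 pnatr_eq0.
Qed.

Lemma walk_cdf m z : P (W m.+2 @^-1` `]-oo, z]) = (record_mean m (fun k => F k.+1 z))%:E.
Proof.
by rewrite -shift_average_heaviside// walk_cdfS walk_cdf_sum mulrC mulKf// pnatr_eq0.
Qed.

Lemma partial_sum_law n z :
  P ((fun t => \sum_(1 <= k < n.+1) X k t) @^-1` `]-oo, z]) = (F n z)%:E.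
Proof.
rewrite -partial_sum_cdf shift_average_heaviside//; congr (P _).
by apply/seteqP; split=> t /=; rewrite partial_sumE.
Qed.
End Walk.

(** * The central limit theorem for the walk *)

Lemma preimage_standardize (T : Type) (R : realType) (Y : T -> R) (a b x : R) : 0 < b ->
  (fun t => (Y t - a) / b) @^-1` `]-oo, x] = Y @^-1` `]-oo, a + b * x].
Proof.
move=> b0; apply/seteqP; split=> t /=;
  by rewrite !in_itv/= ler_pdivrMr// lerBlDl mulrC.
Qed.

Lemma gauss_cdf_continuous_at (R : realType) (x : R) :
  {for x, continuous (fun y : R => normal_prob (0 : R) 1 `]-oo, y]%classic)}.
Proof.
rewrite (_ : (fun y => _) = EFin \o (@gauss_cdf R)); last first.
  by apply/funext => y; rewrite gauss_cdfE.
apply/fine_cvgP; split; last exact: continuous_gauss_cdf.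
by apply: nearW.
Qed.

Theorem mainTheorem4 (d : measure_display) (T : measurableType d)
    (R : realType) (P : probability T R)
    (U : nat -> {RV P >-> nat}) (X : nat -> {RV P >-> R})
    (W : nat -> {RV P >-> R})
    (U_indep : mutually_independent [set n | (1 <= n)%N] U)
    (U_unif : forall n, (1 <= n)%N -> uniform_on_1_to n (U n))
    (X_indep : mutually_independent [set n | (1 <= n)%N] X)
    (X_ident : identically_distributed [set n | (1 <= n)%N] X)
    (XU_indep : independent_families [set n | (1 <= n)%N] X U)
    (W_walk : uniformly_reverting_walk U X W) :
  obeys_CLT P (fun n t => \sum_(1 <= k < n.+1) X k t) ->
  obeys_CLT P W.
Proof.
move=> [a [b [b0 clt]]].
have mX : measurable_fun setT (X 1%N) by [].
have cltF x : sum_cdf P (X 1%N) n (a n + b n * x) @[n --> \oo] --> gauss_cdf x.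
  have := clt x (@gauss_cdf_continuous_at R x).
  rewrite [X in _ --> X]gauss_cdfE => /fine_cvgP[_]; apply: cvg_trans; apply: near_eq_cvg.
  exists 1%N => // n /= n1.
  rewrite /= (preimage_standardize _ _ _ (b0 n n1)).
  by rewrite (partial_sum_law U_indep X_indep X_ident XU_indep).
have [a' [b' [b'0 lim]]] := record_sum_limit mX b0 cltF.
exists (fun n => a' n.-2), (fun n => b' n.-2); split=> // x _.
rewrite [X in _ --> X]gauss_cdfE; apply/fine_cvgP; split.
  apply: nearW => n; rewrite preimage_standardize// fin_num_measure//.
  exact: measurable_preimage.
apply: cvg_trans (lim x); rewrite -(cvg_shiftn 2); apply: near_eq_cvg.
apply: nearW => m /=; rewrite addn2 /= (preimage_standardize _ _ _ (b'0 m)).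
by rewrite (walk_cdf U_indep U_unif X_indep X_ident XU_indep W_walk).
Qed.
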